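(* Let $(X,\mu)$ and $(Y,\nu)$ be standard probability spaces, and let $R$ and $S$ be countable Borel measure-preserving equivalence relations on $(X,\mu)$ and $(Y,\nu)$, respectively. Then $(X,\mu,R)$ and $(Y,\nu,S)$ are both sofic if and only if $(X\times Y,\mu\times\nu,R\times S)$ is sofic.
   Context: A standard probability space $(X,\mu)$ is a standard Borel space with a Borel probability measure. A countable Borel equivalence relation $R$ on $X$ is an equivalence relation that is Borel in $X\times X$ with all classes countable. $[[R]]_B$ is the set of Borel isomorphisms $g:\operatorname{dom}g\to\operatorname{ran}g$ between Borel subsets of $X$ with $(x,gx)\in R$ for all $x\in\operatorname{dom}g$; it is an inverse monoid under composition of partial maps. $R$ is measure-preserving if $\mu(g(A))=\mu(A)$ for all $g\in[[R]]_B$ and Borel $A\subseteq\operatorname{dom}g$. The full semigroup $[[R]]$ is the quotient of $[[R]]_B$ by the pseudometric $d_\mu(g,h)=\mu(\operatorname{dom}g\triangle\operatorname{dom}h)+\mu\{x\in\operatorname{dom}g\cap\operatorname{dom}h:gx\ne hx\}$. For $N\in\mathbb{N}$, $[N]=\{0,\dots,N-1\}$ carries normalized counting measure $\mu_\#$, $[[N]]$ is the set of all partial bijections of $[N]$, and $d_\#$ is the analogous metric on $[[N]]$ defined with $\mu_\#$. The system $(X,\mu,R)$ is sofic if for each finite $K\subseteq[[R]]$ and $\epsilon>0$ there exist $N\in\mathbb{N}$ and $\pi:[[R]]\to[[N]]$ with: (i) $\pi(\operatorname{id}_X)=1_{[N]}$ and $\pi(\varnothing)=\varnothing$; (ii)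 $d_\#(\pi(\varphi\psi),\pi(\varphi)\pi(\psi))<\epsilon$ for all $\varphi,\psi\in K$; (iii) $|\mu\{x:\varphi(x)=x\}-\mu_\#\{m:\pi(\varphi)(m)=m\}|<\epsilon$ for all $\varphi\in K$. $R\times S$ is the equivalence relation on $X\times Y$ in which $(x,y)$ and $(x',y')$ are equivalent iff $(x,x')\in R$ and $(y,y')\in S$. *)

(* Defs.v *)
From HB Require Import structures.
From mathcomp Require Import all_boot all_order all_algebra.
From mathcomp Require Import all_classical all_reals all_analysis.

Set Implicit Arguments.
Unset Strict Implicit.
Unset Printing Implicit Defensive.
Import Order.TTheory GRing.Theory Num.Theory.
Local Open Scope classical_set_scope.
Local Open Scope ring_scope.

(* The sigma-algebra of X is transported from the Borel sigma-algebra of a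
   complete separable metric space along a bijection.  The library's
   completePseudoMetricType is not used because it need not be Hausdorff. *)
Definition standard_borel (F : realType) d (X : measurableType d) : Prop :=
  exists (M : metricType F) (e : X -> M),
    [/\ bijective e,
        forall G : set_system M, ProperFilter G -> cauchy G -> exists l : M, G --> l,
        exists2 D : set M, countable D & dense D &
        forall A : set X, measurable A <-> <<s open >> (e @` A)].

(* Partial injections of T; None means undefined, so that two of them
   are equal as soon as they agree as partial maps. *)
Record pinj (T : Type) := PInj {
  pfun :> T -> option T;
  pinjP : forall x x' y, pfun x = Some y -> pfun x' = Some y -> x = x' }.

Section PartialInjections.
Variable T : Type.
Implicit Types g h : pinj T.

Definition pdom g : set T := [set x | g x].
Definition pimage g (A : set T) : set T := Some @^-1` (g @` A).
Definition ppreimage g (A : set T) : set T := g @^-1` (Some @` A).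
Definition pfix g : set T := [set x | g x = Some x].

Lemma pinj_id_subproof (x x' y : T) : Some x = Some y -> Some x' = Some y -> x = x'.
Proof. by move=> [->] [->]. Qed.
Definition pinj_id := PInj pinj_id_subproof.

Lemma pinj_empty_subproof (x x' y : T) :
  None = Some y -> None = Some y -> x = x'.
Proof. by []. Qed.
Definition pinj_empty := PInj pinj_empty_subproof.

Lemma pinj_comp_subproof g h x x' y :
  pcomp g h x = Some y -> pcomp g h x' = Some y -> x = x'.
Proof.
rewrite /pcomp; case hx: (h x) => [z|//] /= gz; case hx': (h x') => [z'|//] /= gz'.
by move: hx'; rewrite -(pinjP gz gz') => /(pinjP hx).
Qed.
Definition pinj_comp g h := PInj (@pinj_comp_subproof g h).

Definition pdist (F : realType) (m : set T -> F) g h : F :=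
  m (pdom g `+` pdom h) +
  m [set x | (pdom g `&` pdom h) x /\ g x <> h x].

Lemma pimage_comp g h A : pimage (pinj_comp g h) A = pimage g (pimage h A).
Proof.
apply/seteqP; split=> y; rewrite /pimage /preimage /=.
  move=> [x Ax]; rewrite /pcomp; case hx: (h x) => [z|//] /= gz.
  by exists z => //; exists x.
move=> [z [x Ax hx] gz]; exists x => //.
by rewrite /pcomp hx.
Qed.

Lemma ppreimage_comp g h A :
  ppreimage (pinj_comp g h) A = ppreimage h (ppreimage g A).
Proof.
apply/seteqP; split=> x; rewrite /ppreimage /preimage /= /pcomp.
  move=> [y Ay]; case: (h x) => [z|//] /= gz.
  by exists z => //; exists y.
by move=> [z [y Ay gz] <-]; exists y.
Qed.

End PartialInjections.

(* Normalized counting measure on [N] = 'I_N. *)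
Definition mu_count (F : realType) (N : nat) (A : set 'I_N) : F :=
  #|[pred i : 'I_N | i \in A]|%:R / N%:R.

(* Countable Borel equivalence relations on X. *)
Record cber d (X : measurableType d) := Cber {
  cber_rel :> X -> X -> Prop;
  cber_refl : forall x, cber_rel x x;
  cber_sym : forall x y, cber_rel x y -> cber_rel y x;
  cber_trans : forall x y z, cber_rel x y -> cber_rel y z -> cber_rel x z;
  cber_borel : measurable [set p : X * X | cber_rel p.1 p.2];
  cber_countable : forall x, countable [set y | cber_rel x y] }.

Section ProductRelation.
Context d1 d2 (X : measurableType d1) (Y : measurableType d2).
Variables (R : cber X) (S : cber Y).

Definition prod_rel (p q : X * Y) : Prop := R p.1 q.1 /\ S p.2 q.2.

Lemma prod_rel_refl p : prod_rel p p.
Proof. by split; exact: cber_refl. Qed.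

Lemma prod_rel_sym p q : prod_rel p q -> prod_rel q p.
Proof. by move=> [Rpq Spq]; split; exact: cber_sym. Qed.

Lemma prod_rel_trans p q r : prod_rel p q -> prod_rel q r -> prod_rel p r.
Proof.
move=> [R1 S1] [R2 S2].
by split; [exact: cber_trans R1 R2|exact: cber_trans S1 S2].
Qed.

Lemma prod_rel_borel :
  measurable [set p : (X * Y) * (X * Y) | prod_rel p.1 p.2].
Proof.
have mR : measurable_fun setT
    (fun p : (X * Y) * (X * Y) => (p.1.1, p.2.1)).
  by apply: measurable_fun_pair;
    [exact: (measurableT_comp measurable_fst measurable_fst)|
     exact: (measurableT_comp measurable_fst measurable_snd)].
have mS : measurable_fun setT
    (fun p : (X * Y) * (X * Y) => (p.1.2, p.2.2)).
  by apply: measurable_fun_pair;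
    [exact: (measurableT_comp measurable_snd measurable_fst)|
     exact: (measurableT_comp measurable_snd measurable_snd)].
have := measurableI _ _ (mR measurableT _ (cber_borel R))
                        (mS measurableT _ (cber_borel S)).
by rewrite !setTI.
Qed.

Lemma prod_rel_countable p : countable [set q | prod_rel p q].
Proof. exact: countableX (cber_countable R p.1) (cber_countable S p.2). Qed.

Definition cber_prod : cber (X * Y)%type :=
  Cber prod_rel_refl prod_rel_sym prod_rel_trans prod_rel_borel
    prod_rel_countable.

End ProductRelation.

(* [[R]]_B.  Taking A = setT in the two measurability conditions gives that
   the domain and the range are Borel. *)
Record borel_fsg d (X : measurableType d) (R : cber X) := BorelFsg {
  fsg_pinj :> pinj X;
  fsg_preimage : forall A, measurable A -> measurable (ppreimage fsg_pinj A);
  fsg_image : forall A, measurable A -> measurable (pimage fsg_pinj A);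
  fsg_rel : forall x y, fsg_pinj x = Some y -> R x y }.

Section BorelFullSemigroup.
Context d (X : measurableType d) (R : cber X).
Implicit Types g h : borel_fsg R.

Lemma borel_id_preimage (A : set X) :
  measurable A -> measurable (ppreimage (@pinj_id X) A).
Proof.
suff -> : ppreimage (@pinj_id X) A = A by [].
by apply/seteqP; split=> x /= => [[y Ay [<-]]|Ax] //; exists x.
Qed.

Lemma borel_id_image (A : set X) :
  measurable A -> measurable (pimage (@pinj_id X) A).
Proof.
suff -> : pimage (@pinj_id X) A = A by [].
by apply/seteqP; split=> x /= => [[y Ay [<-]]|Ax] //; exists x.
Qed.

Lemma borel_id_rel (x y : X) : pinj_id X x = Some y -> R x y.
Proof. by move=> [<-]; exact: cber_refl. Qed.

Definition borel_id : borel_fsg R :=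
  BorelFsg borel_id_preimage borel_id_image borel_id_rel.

Lemma borel_empty_preimage (A : set X) :
  measurable A -> measurable (ppreimage (@pinj_empty X) A).
Proof.
suff -> : ppreimage (@pinj_empty X) A = set0 by [].
by apply/seteqP; split=> x // -[].
Qed.

Lemma borel_empty_image (A : set X) :
  measurable A -> measurable (pimage (@pinj_empty X) A).
Proof.
suff -> : pimage (@pinj_empty X) A = set0 by [].
by apply/seteqP; split=> x // -[].
Qed.

Lemma borel_empty_rel (x y : X) : pinj_empty X x = Some y -> R x y.
Proof. by []. Qed.

Definition borel_empty : borel_fsg R :=
  BorelFsg borel_empty_preimage borel_empty_image borel_empty_rel.

Lemma borel_comp_preimage g h A :
  measurable A -> measurable (ppreimage (pinj_comp g h) A).
Proof. by rewrite ppreimage_comp => mA; do 2 apply: fsg_preimage. Qed.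

Lemma borel_comp_image g h A :
  measurable A -> measurable (pimage (pinj_comp g h) A).
Proof. by rewrite pimage_comp => mA; do 2 apply: fsg_image. Qed.

Lemma borel_comp_rel g h x y : pinj_comp g h x = Some y -> R x y.
Proof.
rewrite /= /pcomp; case hx: (h x) => [z|//] /= gz.
exact: cber_trans (fsg_rel hx) (fsg_rel gz).
Qed.

Definition borel_comp g h : borel_fsg R :=
  BorelFsg (@borel_comp_preimage g h) (@borel_comp_image g h)
    (@borel_comp_rel g h).

End BorelFullSemigroup.

Definition measure_preserving (F : realType) d (X : measurableType d)
    (mu : probability X F) (R : cber X) : Prop :=
  forall (g : borel_fsg R) (A : set X),
    measurable A -> A `<=` pdom g -> mu (pimage g A) = mu A.

Section Sofic.
Context (F : realType) d (X : measurableType d).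
Variables (mu : probability X F) (R : cber X).

Definition d_mu (g h : borel_fsg R) : F := pdist (fun A => fine (mu A)) g h.

Definition d_count (N : nat) (f g : pinj 'I_N) : F := pdist (@mu_count F N) f g.

(* [[R]]: an element is a class of the quotient of [[R]]_B by d_mu. *)
Record fsg := Fsg {
  fsg_class :> set (borel_fsg R);
  fsg_classP : exists g, fsg_class = [set h | d_mu g h = 0] }.

Definition fsg_of (g : borel_fsg R) : fsg :=
  Fsg (ex_intro _ g erefl).

(* The product of two classes and the measure of the fixed points of a class
   are computed on representatives; conditions (ii) and (iii) are required for
   all representatives, on which they do not depend when X is standard Borel
   and R preserves mu. *)
Definition sofic : Prop :=
  forall (K : set fsg) (eps : F), finite_set K -> 0 < eps ->
  exists (N : nat) (pi : fsg -> pinj 'I_N), (0 < N)%N /\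
    [/\ pi (fsg_of (borel_id R)) = pinj_id 'I_N,
        pi (fsg_of (borel_empty R)) = pinj_empty 'I_N,
        forall g h, K (fsg_of g) -> K (fsg_of h) ->
          d_count (pi (fsg_of (borel_comp g h)))
                  (pinj_comp (pi (fsg_of g)) (pi (fsg_of h))) < eps &
        forall g, K (fsg_of g) ->
          `| fine (mu (pfix g)) - mu_count F (pfix (pi (fsg_of g))) | < eps].

End Sofic.

(* Main.v *)
Require Import Defs.
From HB Require Import structures.
From mathcomp Require Import all_boot all_order all_algebra.
From mathcomp Require Import all_classical all_reals all_analysis.
From mathcomp Require Import lra.

(** Write [lam] for the product measure.  If the product is sofic, so is each
    factor, because [g |-> g x id] and [h |-> id x h] embed the full semigroups
    of [R] and [S] in that of the product and preserve products and the measures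
    of fixed point sets ([sofic_embed]).

    For the converse, the approximations of [R] and [S] have to be combined into
    one of [R x S], which requires writing an element [phi] of the full semigroup
    of the product, up to a small error, as a finite union of pieces [g x h].

    Such pieces exist locally ([locally_product]): every set [A] of positive
    measure in the domain of [phi] contains a set of positive measure on which
    [phi] is some [g x h].  Indeed the first coordinate of [phi (x, y)] takes, for
    fixed [x], countably many values, so two independent values of [y] have a
    positive probability to give the same one, and by Fubini some [y0] can be
    used for a set of positive measure of points ([repeated_value]): there the
    first coordinate of [phi] does not depend on [y].  Likewise the second one is
    made independent of [x].  The two functions of one variable obtained in this
    way are restrictions of [phi] to parts of a horizontal and a vertical line
    that [phi] maps to such lines, hence they are Borel isomorphisms
    between Borel subsets of [X] and of [Y].  An exhaustion argument then covers the domain of [phi] up to a set of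
    small measure.  This gives at the same time that [R x S] preserves [lam]
    ([pr_image_ge]) and, after approximating Borel sets by finite unions of
    rectangles, the finite families of pieces ([exists_pieces]).

    The approximations are combined by means of local types.  Fix finitely many
    elements of the full semigroup of [R].  The local type of a point says which
    relations of length two between these elements and their inverses hold at
    this point.  Soficity provides partial injections of some finite set [M] for
    which the distribution of the local types of the points of [M] is close to
    the one in [X] ([sofic_matches_local_types]).  Doing the same for [S] with a
    finite set [N], the joint distribution of the types of the two coordinates of
    a point of [M x N] is close to the one in [X x Y] ([joint_statistics]).  The
    model of [phi] moves a point by one of the pieces of [phi] when the type of
    the point guarantees that the outcome is unambiguous and not shared with
    another point.  That the pieces of [phi], [psi] and [phi psi] are compatible
    at a point, and that a piece fixes the point, are properties of its type too,
    so that their frequencies in [M x N] are close to their probabilities in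
    [X x Y] ([model_comp], [model_fix]). *)

Set Implicit Arguments.
Unset Strict Implicit.
Unset Printing Implicit Defensive.
Import Order.TTheory GRing.Theory Num.Theory.
Local Open Scope classical_set_scope.
Local Open Scope ring_scope.

(** * Real-valued probabilities *)

Definition pr (F : realType) d (T : measurableType d) (P : probability T F)
  (A : set T) : F := fine (P A).

Section RealProbability.
Context (F : realType) d (T : measurableType d) (P : probability T F).
Implicit Types A B : set T.

Lemma prE A : measurable A -> P A = (pr P A)%:E.
Proof. by move=> mA; rewrite /pr fineK// fin_num_measure. Qed.

Lemma pr_ge0 A : 0 <= pr P A.
Proof. by rewrite /pr fine_ge0. Qed.

Lemma pr_set0 : pr P set0 = 0.
Proof. by rewrite /pr measure0. Qed.

Lemma pr_setT : pr P setT = 1.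
Proof. by rewrite /pr probability_setT. Qed.

Lemma le_pr A B : measurable A -> measurable B -> A `<=` B -> pr P A <= pr P B.
Proof.
move=> mA mB AB; rewrite -lee_fin -!prE//.
by apply: le_measure; rewrite ?inE.
Qed.

Lemma pr_le1 A : measurable A -> pr P A <= 1.
Proof. by move=> mA; rewrite -pr_setT; apply: le_pr. Qed.

Lemma pr_setU A B : measurable A -> measurable B -> A `&` B = set0 ->
  pr P (A `|` B) = pr P A + pr P B.
Proof.
move=> mA mB AB; apply: EFin_inj; rewrite EFinD -!prE ?measureU//.
exact: measurableU.
Qed.

Lemma pr_split A B : measurable A -> measurable B ->
  pr P A = pr P (A `&` B) + pr P (A `\` B).
Proof.
move=> mA mB; rewrite -pr_setU; [|exact: measurableI|exact: measurableD|].
  by rewrite setUIDK.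
by apply/seteqP; split=> x // -[[_ Bx] [_]].
Qed.

Lemma pr_setC A : measurable A -> pr P (~` A) = 1 - pr P A.
Proof.
move=> mA; have := pr_split measurableT mA.
by rewrite setTI setTD pr_setT => ->; rewrite addrAC subrr add0r.
Qed.

Lemma pr_setU_le A B : measurable A -> measurable B ->
  pr P (A `|` B) <= pr P A + pr P B.
Proof.
move=> mA mB; have mAB := measurableU _ _ mA mB.
rewrite (pr_split mAB mA) setUK lerD2l.
apply: le_pr => //; first exact: measurableD.
by move=> x [[]].
Qed.

Lemma pr_subU A B C : measurable A -> measurable B -> measurable C ->
  A `<=` B `|` C -> pr P A <= pr P B + pr P C.
Proof.
move=> mA mB mC ABC; apply: le_trans (pr_setU_le mB mC).
by apply: le_pr => //; exact: measurableU.
Qed.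

Lemma measurable_seq (I : eqType) (r : seq I) (B : I -> set T) :
  (forall i, measurable (B i)) -> measurable [set x | exists2 i, i \in r & B i x].
Proof.
move=> mB; elim: r => [|i r IH].
  by rewrite (_ : mkset _ = set0)//; apply/seteqP; split=> x // -[].
rewrite (_ : mkset _ = B i `|` [set x | exists2 i, i \in r & B i x]).
  exact: measurableU.
apply/seteqP; split=> x /=.
  by move=> [j]; rewrite inE => /orP[/eqP->|jr] Bj; [left|right; exists j].
by move=> [Bi|[j jr Bj]]; [exists i => //|exists j => //]; rewrite inE ?eqxx// jr orbT.
Qed.

Lemma measurable_fin (I : finType) (B : I -> set T) :
  (forall i, measurable (B i)) -> measurable [set x | exists i, B i x].
Proof.
move=> mB; rewrite (_ : mkset _ = [set x | exists2 i, i \in enum I & B i x]).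
  exact: measurable_seq.
by apply/seteqP; split=> x [i]; [exists i; rewrite ?mem_enum|exists i].
Qed.

Lemma pr_fin_additive (I : eqType) (r : seq I) (B : I -> set T) :
  uniq r -> (forall i, measurable (B i)) ->
  (forall i j x, B i x -> B j x -> i = j) ->
  pr P [set x | exists2 i, i \in r & B i x] = \sum_(i <- r) pr P (B i).
Proof.
move=> + mB dB; elim: r => [_|i r IH /= /andP[ir ur]].
  by rewrite big_nil (_ : mkset _ = set0) ?pr_set0//; apply/seteqP; split=> x // -[].
rewrite big_cons -IH// -pr_setU//.
- congr (pr P _); apply/seteqP; split=> x /=.
    by move=> [j]; rewrite inE => /orP[/eqP->|jr] Bj; [left|right; exists j].
  by move=> [Bi|[j jr Bj]]; [exists i => //|exists j => //]; rewrite inE ?eqxx// jr orbT.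
- exact: measurable_seq.
- apply/seteqP; split=> x // -[Bi [j jr Bj]].
  by move: ir; rewrite (dB _ _ _ Bi Bj) jr.
Qed.

Lemma pr_fibers (I : finType) (f : T -> I) (Q : pred I) :
  (forall i, measurable [set x | f x = i]) ->
  pr P [set x | Q (f x)] = \sum_(i | Q i) pr P [set x | f x = i].
Proof.
move=> mf; rewrite -[RHS]big_filter -pr_fin_additive//.
- congr (pr P _); apply/seteqP; split=> x /=.
    by move=> Qx; exists (f x) => //; rewrite mem_filter mem_index_enum Qx.
  by move=> [i]; rewrite mem_filter mem_index_enum andbT => Qi ->.
- by rewrite filter_uniq// index_enum_uniq.
- by move=> i j x /= <- <-.
Qed.

Lemma measurable_fibers (I : finType) (f : T -> I) (Q : I -> Prop) :
  (forall i, measurable [set x | f x = i]) -> measurable [set x | Q (f x)].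
Proof.
move=> mf; rewrite (_ : mkset _ =
  [set x | exists2 i, i \in [seq i <- enum I | `[< Q i >]] & [set x | f x = i] x]).
  exact: measurable_seq.
apply/seteqP; split=> x /=.
  by move=> Qx; exists (f x) => //; rewrite mem_filter mem_enum andbT; apply/asboolP.
by move=> [i]; rewrite mem_filter => /andP[/asboolP Qi _] ->.
Qed.

End RealProbability.

(** * Normalized counting measure on a finite type *)

Section Counting.
Context (F : realType) (T : finType).
Implicit Types A B : set T.

Definition cnt A : F := #|[pred i : T | i \in A]|%:R / #|T|%:R.

Lemma cntE A : cnt A = (\sum_(i : T) (`[< A i >] : nat))%:R / #|T|%:R.
Proof.
by rewrite /cnt -sum1_card big_mkcond.
Qed.

Lemma cnt_ge0 A : 0 <= cnt A.
Proof. by rewrite /cnt divr_ge0. Qed.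

Lemma le_cnt A B : A `<=` B -> cnt A <= cnt B.
Proof.
move=> AB; rewrite !cntE ler_wpM2r ?invr_ge0// ler_nat; apply: leq_sum => i _.
by do 2 case: asboolP => //; move=> nBi /AB.
Qed.

Lemma cnt_set0 : cnt set0 = 0.
Proof.
by rewrite cntE big1 ?mul0r// => i _; rewrite asboolF.
Qed.

Lemma cnt_setT : (0 < #|T|)%N -> cnt setT = 1.
Proof.
move=> T0; rewrite cntE (eq_bigr (fun=> 1%N)) => [|i _]; last by rewrite asboolT.
by rewrite sum1_card divff// pnatr_eq0 -lt0n.
Qed.

Lemma cnt_setU_le A B : cnt (A `|` B) <= cnt A + cnt B.
Proof.
rewrite !cntE -mulrDl ler_wpM2r ?invr_ge0// -natrD ler_nat -big_split/=.
apply: leq_sum => i _.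
by case: asboolP => [[]|//] ?; do 2 case: asboolP.
Qed.

Lemma cnt_subU A B C : A `<=` B `|` C -> cnt A <= cnt B + cnt C.
Proof. by move=> ABC; apply: le_trans (cnt_setU_le _ _); exact: le_cnt. Qed.

Lemma cnt_disjU A B : A `&` B = set0 -> cnt (A `|` B) = cnt A + cnt B.
Proof.
move=> AB; rewrite !cntE -mulrDl -natrD -big_split/=; congr (_%:R / _).
apply: eq_bigr => i _; have : ~ (A `&` B) i by rewrite AB.
move=> nAB.
case: (asboolP (A i)) => Ai; case: (asboolP (B i)) => Bi.
- by case: nAB.
- by rewrite asboolT//; left.
- by rewrite asboolT//; right.
- by rewrite asboolF// => -[].
Qed.

Lemma cnt_fin_le (I : finType) A (B : I -> set T) :
  (forall x, A x -> exists i, B i x) -> cnt A <= \sum_i cnt (B i).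
Proof.
move=> AB; suff H (r : seq I) C : (forall x, C x -> exists2 i, i \in r & B i x) ->
    cnt C <= \sum_(i <- r) cnt (B i).
  by rewrite -big_enum/=; apply: H => x /AB[i Bi]; exists i; rewrite ?mem_enum.
elim: r C => [|i r IH] C CB.
  by rewrite big_nil (_ : C = set0) ?cnt_set0//; apply/seteqP; split=> x // /CB[].
rewrite big_cons; apply: (@le_trans _ _ (cnt (B i) + cnt (C `\` B i))).
  by apply: cnt_subU => x Cx; have [Bx|nBx] := pselect (B i x); [left|right].
rewrite lerD2l; apply: IH => // x [/CB[j]]; rewrite inE => /orP[/eqP-> //|jr Bj _].
by exists j.
Qed.

Lemma cnt_fibers (I : finType) (f : T -> I) (Q : pred I) :
  cnt [set x | Q (f x)] = \sum_(i | Q i) cnt [set x | f x = i].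
Proof.
rewrite cntE [RHS](eq_bigr _ (fun i _ => cntE _)).
rewrite -mulr_suml -natr_sum exchange_big/=; congr (_%:R / _).
apply: eq_bigr => x _.
rewrite (eq_bigr (fun i => (f x == i) : nat)); last first.
  by move=> i _; congr nat_of_bool; apply/asboolP/eqP.
rewrite big_mkcond (bigD1 (f x))//= eqxx big1 ?addn0.
  by case: (Q _) (asboolP (Q (f x))) => -[].
by move=> i /negbTE; rewrite eq_sym => ->; case: ifP.
Qed.

End Counting.
Arguments cnt F {T} A.

Lemma cnt_bij (F : realType) (T U : finType) (f : T -> U) (A : set U) :
  bijective f -> cnt F (f @^-1` A) = cnt F A.
Proof.
move=> fb; rewrite !cntE (bij_eq_card fb); congr (_%:R / _).
by rewrite [RHS](reindex f)//; exact: onW_bij.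
Qed.

Lemma cnt_setX (F : realType) (T U : finType) (A : set T) (B : set U) :
  cnt F (A `*` B) = cnt F A * cnt F B.
Proof.
rewrite !cntE card_prod natrM invfM mulrACA -natrM; congr (_%:R * _).
rewrite big_distrlr/= pair_big/=; apply: eq_bigr => -[x y] _ /=.
rewrite mulnb; congr nat_of_bool; apply/asboolP/andP => /=.
  by move=> [? ?]; split; apply/asboolP.
by move=> [/asboolP ? /asboolP ?].
Qed.

(** * The inverse monoid of partial Borel isomorphisms *)

Section PartialInverse.
Variable T : Type.
Implicit Types g : pinj T.

Definition inv_fun g (y : T) : option T :=
  if pselect (exists x, g x = Some y) is left e then Some (projT1 (cid e)) else None.

Lemma inv_funE g x y : inv_fun g y = Some x <-> g x = Some y.
Proof.
rewrite /inv_fun; case: pselect => [e|ne]; last first.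
  by split=> // gx; case: ne; exists x.
case: cid => z /= gz; split=> [[<-]//|gx].
by rewrite (pinjP gz gx).
Qed.

Lemma pinj_inv_subproof g x x' y :
  inv_fun g x = Some y -> inv_fun g x' = Some y -> x = x'.
Proof. by move=> /inv_funE gy /inv_funE; rewrite gy => -[]. Qed.

Definition pinj_inv g := PInj (@pinj_inv_subproof g).

Lemma pinj_invE g x y : pinj_inv g y = Some x <-> g x = Some y.
Proof. exact: inv_funE. Qed.

Lemma ppreimageP g A x : ppreimage g A x <-> exists2 y, A y & g x = Some y.
Proof. by split=> -[y Ay gx]; exists y. Qed.

Lemma pdomP g x : pdom g x <-> exists y, g x = Some y.
Proof.
rewrite /pdom/=; split; first by case: (g x) => [y|//] _; exists y.
by move=> [y ->].
Qed.

Lemma pdomPn g x : ~ pdom g x <-> g x = None.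
Proof. by rewrite /pdom/=; case: (g x) => [y|]; split=> // /(_ isT). Qed.

Lemma ppreimageT g : ppreimage g setT = pdom g.
Proof.
by apply/seteqP; split=> x; [move=> /ppreimageP[y _ gx]|move=> /pdomP[y gx]];
  [apply/pdomP|apply/ppreimageP]; exists y.
Qed.

Lemma pimage_inv g A : pimage (pinj_inv g) A = ppreimage g A.
Proof.
apply/seteqP; split=> x; first by move=> [y Ay /pinj_invE gx]; apply/ppreimageP; exists y.
by move=> /ppreimageP[y Ay gx]; exists y => //; apply/pinj_invE.
Qed.

Lemma ppreimage_inv g A : ppreimage (pinj_inv g) A = pimage g A.
Proof.
apply/seteqP; split=> x; first by move=> /ppreimageP[y Ay /pinj_invE gx]; exists y.
by move=> [y Ay gx]; apply/ppreimageP; exists y => //; apply/pinj_invE.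
Qed.

Lemma pcompE (g h : pinj T) x :
  pinj_comp g h x = if h x is Some y then g y else None.
Proof. by rewrite /= /pcomp; case: (h x). Qed.

Definition on_fun (A : set T) (x : T) : option T :=
  if pselect (A x) then Some x else None.

Lemma on_funP A x y : on_fun A x = Some y <-> A x /\ x = y.
Proof. by rewrite /on_fun; by case: pselect => Ax /=; split=> [|[? <-]] // [<-]. Qed.

Lemma pinj_on_subproof A x x' y :
  on_fun A x = Some y -> on_fun A x' = Some y -> x = x'.
Proof. by move=> /on_funP[_ ->] /on_funP[_ ->]. Qed.

Definition pinj_on A := PInj (@pinj_on_subproof A).

Lemma pinj_onP A x y : pinj_on A x = Some y <-> A x /\ x = y.
Proof. exact: on_funP. Qed.

Lemma pinj_onT A x : A x -> pinj_on A x = Some x.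
Proof. by move=> Ax; apply/pinj_onP. Qed.

Lemma pinj_onF A x : ~ A x -> pinj_on A x = None.
Proof. by move=> Ax; rewrite /= /on_fun; case: pselect. Qed.

Definition tot g x := odflt x (g x).

Lemma tot_Some g x y : g x = Some y -> tot g x = y.
Proof. by rewrite /tot => ->. Qed.

Lemma pdom_tot g x : pdom g x -> g x = Some (tot g x).
Proof. by move=> /pdomP[y gx]; rewrite /tot gx. Qed.

End PartialInverse.

Definition prod_fun T U (g : T -> option T) (h : U -> option U) (p : T * U) :
    option (T * U) :=
  if g p.1 is Some x then if h p.2 is Some y then Some (x, y) else None else None.

Lemma prod_funP T U (g : T -> option T) (h : U -> option U) p q :
  prod_fun g h p = Some q <-> g p.1 = Some q.1 /\ h p.2 = Some q.2.
Proof.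
rewrite /prod_fun; case: p q => [x y] [x' y'] /=.
by case: (g x) => [a|]; case: (h y) => [b|]; split=> //;
  by [case=> -> ->|case=> -[->] [->]|case].
Qed.

Lemma pinj_prod_subproof T U (g : pinj T) (h : pinj U) p p' q :
  prod_fun g h p = Some q -> prod_fun g h p' = Some q -> p = p'.
Proof.
case: p p' => [x y] [x' y'] /prod_funP[/= gx hy] /prod_funP[/= gx' hy'].
by rewrite (pinjP gx gx') (pinjP hy hy').
Qed.

Definition pinj_prod T U (g : pinj T) (h : pinj U) := PInj (@pinj_prod_subproof T U g h).

Lemma pinj_prodP T U (g : pinj T) (h : pinj U) p q :
  pinj_prod g h p = Some q <-> g p.1 = Some q.1 /\ h p.2 = Some q.2.
Proof. exact: prod_funP. Qed.

Lemma option_ext T (a b : option T) :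
  (forall y, a = Some y <-> b = Some y) -> a = b.
Proof.
case: a => [x|] ab; first by apply/esym/ab.
by case: b ab => // y ab; apply/ab.
Qed.

Section FullSemigroup.
Context d (X : measurableType d) (R : cber X).
Implicit Types g h : borel_fsg R.

Lemma borel_inv_preimage g A : measurable A -> measurable (ppreimage (pinj_inv g) A).
Proof. by move=> mA; rewrite ppreimage_inv; exact: fsg_image. Qed.

Lemma borel_inv_image g A : measurable A -> measurable (pimage (pinj_inv g) A).
Proof. by move=> mA; rewrite pimage_inv; exact: fsg_preimage. Qed.

Lemma borel_inv_rel g x y : pinj_inv g x = Some y -> R x y.
Proof. by move=> /pinj_invE/fsg_rel; exact: cber_sym. Qed.

Definition borel_inv g : borel_fsg R :=
  BorelFsg (@borel_inv_preimage g) (@borel_inv_image g) (@borel_inv_rel g).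

Lemma borel_invP g x y : borel_inv g y = Some x <-> g x = Some y.
Proof. exact: pinj_invE. Qed.

Lemma borel_on_preimage (A : set X) : measurable A ->
  forall B, measurable B -> measurable (ppreimage (pinj_on A) B).
Proof.
move=> mA B mB; rewrite (_ : ppreimage _ _ = A `&` B); first exact: measurableI.
apply/seteqP; split=> x; first by move=> /ppreimageP[y By /pinj_onP[Ax xy]]; split=> //; rewrite xy.
by move=> [Ax Bx]; apply/ppreimageP; exists x => //; apply/pinj_onP.
Qed.

Lemma borel_on_image (A : set X) : measurable A ->
  forall B, measurable B -> measurable (pimage (pinj_on A) B).
Proof.
move=> mA B mB; rewrite (_ : pimage _ _ = A `&` B); first exact: measurableI.
apply/seteqP; split=> x; first by move=> [y By /pinj_onP[Ax <-]].
by move=> [Ax Bx]; exists x => //; apply/pinj_onP.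
Qed.

Lemma borel_on_rel (A : set X) x y : pinj_on A x = Some y -> R x y.
Proof. by move=> /pinj_onP[_ <-]; exact: cber_refl. Qed.

Definition borel_on (A : set X) (mA : measurable A) : borel_fsg R :=
  BorelFsg (borel_on_preimage mA) (borel_on_image mA) (@borel_on_rel A).

Lemma measurable_pdom g : measurable (pdom g).
Proof. by rewrite -ppreimageT; exact: fsg_preimage. Qed.

Lemma measurable_tot g : measurable_fun setT (tot g).
Proof.
move=> _ B mB; rewrite setTI.
rewrite (_ : _ @^-1` _ = ppreimage g B `|` (B `\` pdom g)).
  apply: measurableU; first exact: fsg_preimage.
  by apply: measurableD => //; exact: measurable_pdom.
apply/seteqP; split=> x /=.
  rewrite /tot; case gx: (g x) => [y|] /= By.
    by left; apply/ppreimageP; exists y.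
  by right; split=> //; apply/pdomPn.
move=> [/ppreimageP[y By gx]|[Bx /pdomPn gx]]; first by rewrite (tot_Some gx).
by rewrite /tot gx.
Qed.

Definition diag_measurable := measurable [set p : X * X | p.1 = p.2].

Lemma measurable_eqfun d' (Z : measurableType d') (f f' : Z -> X) :
  diag_measurable -> measurable_fun setT f -> measurable_fun setT f' ->
  measurable [set z | f z = f' z].
Proof.
move=> mD mf mf'; have := measurable_fun_pair mf mf' measurableT mD.
by rewrite setTI.
Qed.

Lemma measurable_eq g h : diag_measurable -> measurable [set x | g x = h x].
Proof.
move=> mD; rewrite (_ : mkset _ = ((pdom g `&` pdom h) `&` [set x | tot g x = tot h x])
   `|` (~` pdom g `&` ~` pdom h)).
  have mg := measurable_pdom g; have mh := measurable_pdom h.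
  apply: measurableU; apply: measurableI.
  - exact: measurableI.
  - by apply: measurable_eqfun => //; exact: measurable_tot.
  - exact: measurableC.
  - exact: measurableC.
apply/seteqP; split=> x /=; rewrite /tot /pdom /=.
  by move=> ->; case: (h x) => [y|]; [left|right].
by case: (g x) (h x) => [y|] [z|] //= [[[]]|[]] //= _ _ ->.
Qed.

Lemma measurable_neq g h : diag_measurable -> measurable [set x | g x <> h x].
Proof. by move=> mD; apply: measurableC; exact: measurable_eq. Qed.

Lemma measurable_pfix g : diag_measurable -> measurable (pfix g).
Proof. exact: (measurable_eq g (borel_id R)). Qed.

End FullSemigroup.

Section ProductElement.
Context d1 d2 (X : measurableType d1) (Y : measurableType d2).
Variables (R : cber X) (S : cber Y).
Implicit Types (g : borel_fsg R) (h : borel_fsg S).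

Lemma borel_prod_preimage g h A :
  measurable A -> measurable (ppreimage (pinj_prod g h) A).
Proof.
move=> mA; pose f (p : X * Y) := (tot g p.1, tot h p.2).
have mf : measurable_fun setT f.
  by apply: measurable_fun_pair; apply: measurableT_comp;
    [exact: measurable_tot|exact: measurable_fst|exact: measurable_tot|exact: measurable_snd].
rewrite (_ : ppreimage _ _ = (pdom g `*` pdom h) `&` f @^-1` A).
  apply: measurableI; first by apply: measurableX; exact: measurable_pdom.
  by have := mf measurableT _ mA; rewrite setTI.
apply/seteqP; split=> -[x y].
  move=> /ppreimageP[[x' y'] Ap /pinj_prodP[/= gx hy]]; split=> /=.
    by split; apply/pdomP => /=; eexists; eassumption.
  by rewrite /f /= (tot_Some gx) (tot_Some hy).
move=> [[/= dx dy] /= Af]; apply/ppreimageP; exists (f (x, y)) => //.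
by apply/pinj_prodP; split; exact: pdom_tot.
Qed.

End ProductElement.

Section ProductElement2.
Context d1 d2 (X : measurableType d1) (Y : measurableType d2).
Variables (R : cber X) (S : cber Y).
Implicit Types (g : borel_fsg R) (h : borel_fsg S).

Lemma borel_prod_image g h A :
  measurable A -> measurable (pimage (pinj_prod g h) A).
Proof.
move=> mA; rewrite (_ : pimage _ _ =
    ppreimage (pinj_prod (borel_inv g) (borel_inv h)) A).
  exact: borel_prod_preimage.
apply/seteqP; split=> q.
  move=> [p Ap /pinj_prodP[gp hp]]; apply/ppreimageP; exists p => //.
  by apply/pinj_prodP; split; apply/borel_invP.
move=> /ppreimageP[p Ap /pinj_prodP[/borel_invP gp /borel_invP hp]].
by exists p => //; apply/pinj_prodP.
Qed.

Lemma borel_prod_rel g h p q : pinj_prod g h p = Some q -> cber_prod R S p q.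
Proof. by move=> /pinj_prodP[/fsg_rel ? /fsg_rel ?]. Qed.

Definition borel_prod g h : borel_fsg (cber_prod R S) :=
  BorelFsg (@borel_prod_preimage _ _ _ _ _ _ g h) (@borel_prod_image g h)
    (@borel_prod_rel g h).

Lemma borel_prodP g h p q :
  borel_prod g h p = Some q <-> g p.1 = Some q.1 /\ h p.2 = Some q.2.
Proof. exact: pinj_prodP. Qed.

Lemma diag_measurable_prod :
  diag_measurable X -> diag_measurable Y -> diag_measurable (X * Y)%type.
Proof.
move=> mX mY; rewrite /diag_measurable (_ : mkset _ =
  [set p : (X * Y) * (X * Y) | p.1.1 = p.2.1] `&`
  [set p : (X * Y) * (X * Y) | p.1.2 = p.2.2]).
  apply: measurableI.
    apply: (measurable_eqfun mX).
      exact: (measurableT_comp measurable_fst measurable_fst).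
    exact: (measurableT_comp measurable_fst measurable_snd).
  apply: (measurable_eqfun mY).
    exact: (measurableT_comp measurable_snd measurable_fst).
  exact: (measurableT_comp measurable_snd measurable_snd).
by apply/seteqP; split=> -[[x y] [x' y']] /= [-> ->].
Qed.

End ProductElement2.

Section Classes.
Context (F : realType) d (X : measurableType d) (mu : probability X F) (R : cber X).
Implicit Types g h k : borel_fsg R.

Lemma fsg_ext (a b : fsg mu R) : fsg_class a = fsg_class b -> a = b.
Proof.
by case: a b => [A HA] [B HB] /= AB; move: HA HB; rewrite AB => HA HB; congr Fsg.
Qed.

Lemma fsg_of_ext g h : g =1 h -> fsg_of mu g = fsg_of mu h.
Proof.
move=> /funext gh; apply: fsg_ext => /=; apply/funext => k.
by rewrite /d_mu /pdist /pdom gh.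
Qed.

Hypothesis mD : diag_measurable X.

Lemma pr_neq_sym g h : pr mu [set x | g x <> h x] = pr mu [set x | h x <> g x].
Proof. by congr (pr mu _); apply/seteqP; split=> x /= + /esym. Qed.

Lemma pr_neq0_trans g h k : pr mu [set x | g x <> h x] = 0 ->
  pr mu [set x | h x <> k x] = 0 -> pr mu [set x | g x <> k x] = 0.
Proof.
move=> gh hk; apply/eqP; rewrite eq_le pr_ge0 andbT.
have := @pr_subU _ _ _ mu _ _ _ (measurable_neq g k mD) (measurable_neq g h mD)
  (measurable_neq h k mD).
rewrite gh hk addr0; apply => x /= gk; have [ghx|] := pselect (g x = h x); last by left.
by right; rewrite -ghx.
Qed.

Lemma d_mu0 g h : d_mu mu g h = 0 <-> pr mu [set x | g x <> h x] = 0.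
Proof.
have mg := measurable_pdom g; have mh := measurable_pdom h.
have mU : measurable (pdom g `+` pdom h).
  by apply: measurableU; exact: measurableD.
have mI : measurable [set x | (pdom g `&` pdom h) x /\ g x <> h x].
  by apply: measurableI; [exact: measurableI|exact: measurable_neq].
have sub : [set x | g x <> h x] = (pdom g `+` pdom h) `|`
    [set x | (pdom g `&` pdom h) x /\ g x <> h x].
  apply/seteqP; split=> x /=; rewrite /pdom /setD /=.
    by case: (g x) (h x) => [y|] [z|] //= ?; [right|left;left|left;right].
  by case: (g x) (h x) => [y|] [z|] //= [[[]|[]]|[]].
have -> : d_mu mu g h = pr mu (pdom g `+` pdom h) +
   pr mu [set x | (pdom g `&` pdom h) x /\ g x <> h x] by [].
split=> [d0|n0].
  apply/eqP; rewrite eq_le pr_ge0 andbT -d0; apply: pr_subU => //.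
    exact: measurable_neq.
  by rewrite sub.
have := le_pr mu mU (measurable_neq g h mD); rewrite {1}sub => /(_ (@subsetUl _ _ _)).
have := le_pr mu mI (measurable_neq g h mD); rewrite {1}sub => /(_ (@subsetUr _ _ _)).
have := pr_ge0 mu (pdom g `+` pdom h).
have := pr_ge0 mu [set x | (pdom g `&` pdom h) x /\ g x <> h x].
rewrite n0; lra.
Qed.

Lemma fsg_of_eqP g h : fsg_of mu g = fsg_of mu h <-> pr mu [set x | g x <> h x] = 0.
Proof.
split=> [/(congr1 (@fsg_class _ _ _ _ _)) /= gh|gh].
  have : [set k | d_mu mu h k = 0] h.
    by apply/d_mu0; rewrite (_ : mkset _ = set0) ?pr_set0//; apply/seteqP; split.
  by rewrite -gh => /d_mu0.
apply: fsg_ext => /=; apply/seteqP; split=> k /= /d_mu0 k0; apply/d_mu0.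
  by apply: pr_neq0_trans k0; rewrite pr_neq_sym.
exact: pr_neq0_trans k0.
Qed.

Lemma fsg_ofK (a : fsg mu R) : exists g, a = fsg_of mu g.
Proof.
have [g ag] := fsg_classP a; exists g; exact: fsg_ext.
Qed.

End Classes.

Lemma countable_enum T (D : set T) :
  countable D -> D = set0 \/ exists f : nat -> T, D = range f.
Proof.
move=> /pfcard_geP[->|[f]]; [by left|right; exists f].
by apply/seteqP; split=> [y /(@surj _ _ _ _ f)[n _ <-]|_ [n _ <-]]; [exists n|exact: funS].
Qed.

Section StandardBorel.
Context (F : realType) d (X : measurableType d).

(** Points of a separable metric space are separated by countably many balls,
    so the complement of the diagonal is a countable union of rectangles. *)
Lemma standard_borel_diag : standard_borel F X -> diag_measurable X.
Proof.
move=> [M [e [[e' eK e'K] _ [D cD dD] mE]]].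
pose B (a : M) (n : nat) := [set y | mdist a y < n.+1%:R^-1 :> F].
have oB a n : open (B a n).
  rewrite openE => y /= ay; apply/nbhs_ballP; exists (n.+1%:R^-1 - mdist a y) => /=.
    by rewrite subr_gt0.
  move=> z; rewrite ballEmdist /= => yz; rewrite /B/=.
  by apply: le_lt_trans (metric_triangle a y z) _; rewrite addrC -ltrBrDr.
have mB a n : measurable (e @^-1` B a n).
  apply/mE; rewrite image_preimage; first exact: sub_sigma_algebra.
  by apply/seteqP; split=> // y _; exists (e' y).
rewrite /diag_measurable (_ : mkset _ =
    ~` (\bigcup_(a in D) \bigcup_n ((e @^-1` B a n) `*` ~` (e @^-1` B a n)))); last first.
  apply/seteqP; split=> -[x y] /=; first by move=> -> [a Da [n _ [/= ? ?]]].
  move=> nxy; apply: contrapT => xy; apply: nxy.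
  have d0 : 0 < mdist (e x) (e y) :> F.
    by rewrite mdist_gt0; apply/eqP => /(can_inj eK).
  have [n _ /= nd] : \forall n \near \oo, n.+1%:R^-1 < mdist (e x) (e y) / 2 :> F.
    exact: (near_infty_natSinv_lt (PosNum (divr_gt0 d0 (ltr0Sn F 1)))).
  have {nd} := nd n (leqnn n) => nd.
  have Bx : B (e x) n (e x) by rewrite /B /= mdistxx invr_gt0.
  have [a [/= xa Da]] := dD (B (e x) n) (ex_intro _ (e x) Bx) (oB _ _).
  exists a => //; exists n => //; split; rewrite /B /=; first by rewrite metric_sym.
  move=> ay; have := metric_triangle (e x) a (e y).
  move: xa; rewrite /B /= => xa; apply/negP; rewrite -ltNge.
  by apply: lt_trans (ltrD xa ay) _; rewrite [ltRHS]splitr ltrD.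
apply: measurableC.
have [->|[f ->]] := countable_enum cD; first by rewrite bigcup_set0.
rewrite bigcup_image; apply: bigcup_measurable => a _.
apply: bigcup_measurable => n _; apply: measurableX => //.
exact: measurableC.
Qed.

End StandardBorel.

(** * Soficity of the factors *)

(** Soficity is expressed with classes, products and measures of fixed point
    sets only, so an approximation for the target can be composed with a map
    that respects them.  Representatives have to be chosen because [Phi] is
    defined on the semigroup and not on its quotient. *)
Lemma sofic_embed (F : realType) d (X : measurableType d) (mu : probability X F)
    (R : cber X) d' (X' : measurableType d') (mu' : probability X' F) (R' : cber X')
    (Phi : borel_fsg R -> borel_fsg R') :
  diag_measurable X -> diag_measurable X' ->
  (forall g h : borel_fsg R, pr mu [set x | g x <> h x] = 0 ->
    pr mu' [set x | Phi g x <> Phi h x] = 0) ->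
  Phi (borel_id R) =1 borel_id R' -> Phi (borel_empty R) =1 borel_empty R' ->
  (forall g h, Phi (borel_comp g h) =1 borel_comp (Phi g) (Phi h)) ->
  (forall g, pr mu' (pfix (Phi g)) = pr mu (pfix g)) ->
  sofic mu' R' -> sofic mu R.
Proof.
move=> mD mD' Phi0 Phi_id Phi_empty Phi_comp Phi_fix sof K eps finK eps0.
have [rep repE] := choice (@fsg_ofK _ _ _ mu R).
have [N [pi [N0 [pi_id pi_empty pi_comp pi_fix]]]] :=
  sof _ eps (finite_image (fun a => fsg_of mu' (Phi (rep a))) finK) eps0.
have piE g : fsg_of mu' (Phi (rep (fsg_of mu g))) = fsg_of mu' (Phi g).
  by apply/fsg_of_eqP => //; apply: Phi0; apply/fsg_of_eqP.
exists N, (fun a => pi (fsg_of mu' (Phi (rep a)))); split=> //; split.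
- by rewrite piE (fsg_of_ext mu' Phi_id).
- by rewrite piE (fsg_of_ext mu' Phi_empty).
- move=> g h Kg Kh; rewrite !piE (fsg_of_ext mu' (Phi_comp g h)).
  by apply: pi_comp; [exists (fsg_of mu g)|exists (fsg_of mu h)].
- move=> g Kg; rewrite piE.
  have -> : fine (mu (pfix g)) = fine (mu' (pfix (Phi g))) by exact/esym/Phi_fix.
  by apply: pi_fix; exists (fsg_of mu g).
Qed.

Lemma pr_prod (F : realType) d1 d2 (X : measurableType d1) (Y : measurableType d2)
    (mu : probability X F) (nu : probability Y F) A B :
  measurable A -> measurable B ->
  pr (mu \x nu)%E (A `*` B) = pr mu A * pr nu B.
Proof.
move=> mA mB; have mAB := product_measure1E mu nu mA mB.
by rewrite /pr [X in fine X]mAB fineM ?fin_num_measure.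
Qed.

Section Factors.
Context (F : realType) d1 d2 (X : measurableType d1) (Y : measurableType d2).
Context (mu : probability X F) (nu : probability Y F) (R : cber X) (S : cber Y).
Hypothesis (mX : diag_measurable X) (mY : diag_measurable Y).

Lemma prod_fun_eqr T U (g h : T -> option T) (p : T * U) :
  prod_fun g Some p = prod_fun h Some p <-> g p.1 = h p.1.
Proof.
by rewrite /prod_fun; case: (g p.1) (h p.1) => [x|] [y|]; split=> // -[->].
Qed.

Lemma prod_fun_eql T U (g h : U -> option U) (p : T * U) :
  prod_fun Some g p = prod_fun Some h p <-> g p.2 = h p.2.
Proof.
by rewrite /prod_fun; case: (g p.2) (h p.2) => [x|] [y|]; split=> // -[->].
Qed.

Lemma sofic_factor1 : sofic (mu \x nu)%E (cber_prod R S) -> sofic mu R.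
Proof.
apply: (sofic_embed (Phi := fun g => borel_prod g (borel_id S))) => //.
- exact: diag_measurable_prod.
- move=> g h gh; rewrite (_ : mkset _ = [set x | g x <> h x] `*` setT).
    by rewrite pr_prod ?gh ?mul0r//; exact: measurable_neq.
  apply/seteqP; split=> p /=; first by move=> gh'; split=> // /prod_fun_eqr.
  by move=> [gh' _] /prod_fun_eqr.
- by case.
- move=> g h [x y]; by rewrite /= /prod_fun /= /pcomp /=; case: (h x).
- move=> g; rewrite (_ : pfix _ = pfix g `*` setT).
    by rewrite pr_prod ?pr_setT ?mulr1//; exact: measurable_pfix.
  apply/seteqP; split=> -[x y]; have [fix1 fix2] := prod_fun_eqr g Some (x, y).
    by move=> /fix1.
  by move=> [gp _]; apply: fix2.
Qed.

Lemma sofic_factor2 : sofic (mu \x nu)%E (cber_prod R S) -> sofic nu S.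
Proof.
apply: (sofic_embed (Phi := borel_prod (borel_id R))) => //.
- exact: diag_measurable_prod.
- move=> g h gh; rewrite (_ : mkset _ = setT `*` [set x | g x <> h x]).
    by rewrite pr_prod ?gh ?mulr0//; exact: measurable_neq.
  apply/seteqP; split=> p /=; first by move=> gh'; split=> // /prod_fun_eql.
  by move=> [_ gh'] /prod_fun_eql.
- by case.
- move=> g h [x y]; by rewrite /= /prod_fun /= /pcomp /=; case: (h y).
- move=> g; rewrite (_ : pfix _ = setT `*` pfix g).
    by rewrite pr_prod ?pr_setT ?mul1r//; exact: measurable_pfix.
  apply/seteqP; split=> -[x y]; have [fix1 fix2] := prod_fun_eql g Some (x, y).
    by move=> /fix1.
  by move=> [_ gp]; apply: fix2.
Qed.

End Factors.

(** * Sections of measurable sets *)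

Section Sections.
Context (F : realType) d1 d2 (X : measurableType d1) (Y : measurableType d2).
Implicit Types (mu : probability X F) (nu : probability Y F) (A : set (X * Y)).

Lemma measurable_xsec A x : measurable A -> measurable [set y | A (x, y)].
Proof. by move=> /(measurable_xsection x); rewrite xsectionE. Qed.

Lemma measurable_ysec A y : measurable A -> measurable [set x | A (x, y)].
Proof. by move=> /(measurable_ysection y); rewrite ysectionE. Qed.

Lemma prod_measureE mu nu A : (mu \x nu)%E A = (\int[mu]_x nu [set y | A (x, y)])%E.
Proof. by apply: eq_integral => x _ /=; rewrite xsectionE. Qed.

Lemma eq_pr_xsec mu nu A A' :
  (forall x, pr nu [set y | A (x, y)] = pr nu [set y | A' (x, y)]) ->
  measurable A -> measurable A' -> pr (mu \x nu)%E A = pr (mu \x nu)%E A'.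
Proof.
move=> AA' mA mA'; rewrite /pr; congr fine; rewrite [LHS]prod_measureE [RHS]prod_measureE.
by apply: eq_integral => x _; rewrite !prE ?AA'//; exact: measurable_xsec.
Qed.

Lemma pr_null_xsec mu nu A : measurable A -> pr (mu \x nu)%E A = 0 ->
  exists N, [/\ measurable N, pr mu N = 0 &
    forall x, ~ N x -> pr nu [set y | A (x, y)] = 0].
Proof.
move=> mA A0; have := prE (mu \x nu)%E mA; rewrite A0 => {}A0.
have mf := measurable_fun_xsection nu mA.
have : ae_eq mu setT (nu \o xsection A) (cst 0%E).
  apply/(ae_eq_integral_abs mu measurableT mf).
  by rewrite -[RHS]A0; apply: eq_integral => x _; rewrite gee0_abs.
move=> [N [mN N0 subN]]; exists N; split=> //; first by rewrite /pr N0.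
move=> x nN; rewrite /pr; suff /(_ Logic.I) : [set: X] x -> (nu \o xsection A) x = 0%E.
  by rewrite /= xsectionE => ->.
by apply: contrapT => nx; apply/nN/subN.
Qed.

Lemma swap_measurable A : measurable A -> measurable [set q : Y * X | A (q.2, q.1)].
Proof. by move=> mA; have := measurable_swap measurableT mA; rewrite setTI. Qed.

Lemma pr_swap mu nu A : measurable A ->
  pr (mu \x nu)%E A = pr (nu \x mu)%E [set q | A (q.2, q.1)].
Proof.
move=> mA; rewrite /pr; congr fine.
transitivity ((mu \x^ nu)%E A).
  by apply: product_measure_unique => // B C mB mC; exact: product_measure2E.
by apply: eq_integral => y _ /=; rewrite xsectionE ysectionE.
Qed.

End Sections.

Lemma eq_pr_ysec (F : realType) d1 d2 (X : measurableType d1) (Y : measurableType d2)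
    (mu : probability X F) (nu : probability Y F) (A A' : set (X * Y)) :
  (forall y, pr mu [set x | A (x, y)] = pr mu [set x | A' (x, y)]) ->
  measurable A -> measurable A' -> pr (mu \x nu)%E A = pr (mu \x nu)%E A'.
Proof.
move=> AA' mA mA'; rewrite (pr_swap mu nu mA) (pr_swap mu nu mA').
by apply: eq_pr_xsec => //; exact: swap_measurable.
Qed.

(** * Elements of the product agree locally with products of elements *)

Section CountableValues.
Context (F : realType) d1 d2 d3 (X : measurableType d1) (Y : measurableType d2)
  (Z : measurableType d3).
Context (mu : probability X F) (nu : probability Y F).

(** On a vertical line that meets [A] in a set of positive measure, [f] has
    countably many values on [A], one of which is taken with positive
    probability; so two independent points of the line have a positive
    probability to share their value, and Fubini's theorem lets one of them be
    fixed. *)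
Lemma repeated_value (f : X * Y -> Z) (A : set (X * Y)) :
  diag_measurable Z -> measurable_fun setT f -> measurable A ->
  (forall x, countable (f @` [set p | A p /\ p.1 = x])) ->
  0 < pr (mu \x nu)%E A ->
  exists y0, 0 < pr (mu \x nu)%E [set p | [/\ A p, A (p.1, y0) & f p = f (p.1, y0)]].
Proof.
move=> mZ mf mA cf Apos.
pose E := [set q : (X * Y) * Y | [/\ A q.1, A (q.1.1, q.2) & f q.1 = f (q.1.1, q.2)]].
have mE : measurable E.
  have m1 : measurable_fun setT (fun q : (X * Y) * Y => q.1) by exact: measurable_fst.
  have m2 : measurable_fun setT (fun q : (X * Y) * Y => (q.1.1, q.2)).
    apply: measurable_fun_pair; last exact: measurable_snd.
    exact: (measurableT_comp measurable_fst measurable_fst).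
  have -> : E = ((fun q => q.1) @^-1` A `&` (fun q => (q.1.1, q.2)) @^-1` A) `&`
      [set q | f q.1 = f (q.1.1, q.2)].
    by apply/seteqP; split=> q [] //= [? ?] ?.
  apply: measurableI.
    apply: measurableI; first by have := m1 measurableT _ mA; rewrite setTI.
    by have := m2 measurableT _ mA; rewrite setTI.
  by apply: measurable_eqfun mZ _ _; apply: measurableT_comp.
apply: contrapT => nE; move: Apos; apply/negP; rewrite -leNgt.
have E0 : pr ((mu \x nu) \x nu)%E E = 0.
  rewrite -(pr_set0 ((mu \x nu) \x nu)%E); apply: eq_pr_ysec => // y0.
  rewrite [RHS](_ : _ = 0); last by rewrite (_ : mkset _ = set0) ?pr_set0.
  apply/eqP; rewrite eq_le pr_ge0 andbT leNgt; apply/negP => pos; apply: nE.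
  by exists y0.
have [N [mN N0 EN]] := pr_null_xsec mE E0.
have mAN : measurable (A `\` N) by exact: measurableD.
have AN0 : pr (mu \x nu)%E (A `\` N) = 0.
  rewrite -(pr_set0 (mu \x nu)%E); apply: eq_pr_xsec => // x.
  rewrite [RHS](_ : _ = 0); last by rewrite (_ : mkset _ = set0) ?pr_set0.
  have mx := measurable_xsec x mAN.
  suff nx : nu.-negligible [set y | (A `\` N) (x, y)].
    by rewrite /pr (measure_negligible mx nx).
  have [V0|[v Vv]] := countable_enum (cf x).
    apply: negligibleS (negligible_set0 _) => y [/= Axy _].
    suff : set0 (f (x, y)) by []; rewrite -V0.
    by exists (x, y).
  pose B n := [set y | (A `\` N) (x, y) /\ f (x, y) = v n].
  apply: (@negligibleS _ _ _ nu (\bigcup_n B n)) => [y [/= Axy nNxy]|].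
    have : range v (f (x, y)) by rewrite -Vv; exists (x, y).
    by move=> [n _ vn]; exists n.
  apply: negligible_bigcup => n.
  have [[y1 [[/= Ay1 nNy1] fy1]]|nB] := pselect (exists y, B n y); last first.
    by apply: negligibleS (negligible_set0 _) => y By; apply: nB; exists y.
  exists [set y | E ((x, y1), y)]; split.
  - exact: measurable_xsec.
  - by rewrite prE ?EN//; exact: measurable_xsec.
  - by move=> y [[/= Axy _] fy]; split=> //=; rewrite fy1 fy.
have := pr_subU (mu \x nu)%E mA mAN mN; rewrite AN0 N0 addr0; apply => p Ap.
by have [?|?] := pselect (N p); [right|left].
Qed.

End CountableValues.

Lemma repeated_value_swap (F : realType) d1 d2 d3 (X : measurableType d1)
    (Y : measurableType d2) (Z : measurableType d3)
    (mu : probability X F) (nu : probability Y F) (f : X * Y -> Z) (A : set (X * Y)) :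
  diag_measurable Z -> measurable_fun setT f -> measurable A ->
  (forall y, countable (f @` [set p | A p /\ p.2 = y])) ->
  0 < pr (mu \x nu)%E A ->
  exists x0, 0 < pr (mu \x nu)%E [set p | [/\ A p, A (x0, p.2) & f p = f (x0, p.2)]].
Proof.
move=> mZ mf mA cf; rewrite pr_swap// => Apos.
have mA' := swap_measurable mA.
have mf' : measurable_fun setT (fun q : Y * X => f (q.2, q.1)).
  apply: measurableT_comp => //; exact: measurable_swap.
have [y|x0 pos] := repeated_value mZ mf' mA' _ Apos.
  apply: sub_countable (cf y); apply: subset_card_le.
  by move=> _ [[y' x] /= [Axy <-] <-]; exists (x, y').
exists x0; rewrite pr_swap//.
have m2 : measurable_fun setT (fun p : X * Y => (x0, p.2)).
  by apply: measurable_fun_pair => //; exact: measurable_snd.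
rewrite (_ : mkset _ = (A `&` (fun p => (x0, p.2)) @^-1` A) `&`
    [set p | f p = f (x0, p.2)]); last by apply/seteqP; split=> q [] //= [? ?] ?.
apply: measurableI.
  by apply: measurableI => //; have := m2 measurableT _ mA; rewrite setTI.
by apply: measurable_eqfun => //; apply: measurableT_comp.
Qed.

(** Composing an element of a full semigroup with the inclusion [i] of a line
    and the inverse of the inclusion [k] of another one is Borel in both
    directions, because these inclusions map Borel sets to Borel sets. *)
Lemma slice_fsg d d' (P : measurableType d) (Z : measurableType d') (Q : cber P)
    (S : cber Z) (phi : borel_fsg Q) (i k : Z -> P) (W : set Z) :
  injective i -> injective k ->
  measurable_fun setT i -> measurable_fun setT k ->
  (forall B, measurable B -> measurable (i @` B)) ->
  (forall B, measurable B -> measurable (k @` B)) ->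
  (forall z z', Q (i z) (k z') -> S z z') -> measurable W ->
  exists h : borel_fsg S, forall z z',
    h z = Some z' <-> W z /\ phi (i z) = Some (k z').
Proof.
move=> ii ik mi mk mi' mk' QS mW.
pose h z := if pselect (exists z', W z /\ phi (i z) = Some (k z')) is left e
  then Some (projT1 (cid e)) else None.
have hE z z' : h z = Some z' <-> W z /\ phi (i z) = Some (k z').
  rewrite /h; case: pselect => [e|ne]; last by split=> // Wz; case: ne; exists z'.
  case: cid => w /= [Ww pw]; split=> [[<-]//|[_]].
  by rewrite pw => -[/ik->].
have hI x x' y : h x = Some y -> h x' = Some y -> x = x'.
  by move=> /hE[_ hx] /hE[_ hx']; apply/ii/(pinjP hx hx').
have hpre A : measurable A -> measurable (ppreimage (PInj hI) A).
  move=> mA; rewrite (_ : ppreimage _ _ = W `&` i @^-1` ppreimage phi (k @` A)).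
    apply: measurableI => //.
    by have := mi measurableT _ (fsg_preimage phi (mk' _ mA)); rewrite setTI.
  apply/seteqP; split=> z.
    by move=> /ppreimageP[z' Az' /hE[Wz pz]]; split=> //; apply/ppreimageP; exists (k z').
  move=> [Wz /ppreimageP[_ [z' Az' <-] pz]]; apply/ppreimageP; exists z' => //.
  exact/hE.
have him A : measurable A -> measurable (pimage (PInj hI) A).
  move=> mA; rewrite (_ : pimage _ _ = k @^-1` pimage phi (i @` (W `&` A))).
    have := mk measurableT _ (fsg_image phi (mi' _ (measurableI _ _ mW mA))).
    by rewrite setTI.
  apply/seteqP; split=> z'.
    by move=> [z Az /hE[Wz pz]]; exists (i z) => //; exists z.
  by move=> [_ [z [Wz Az] <-] pz]; exists z => //; apply/hE.
have hrel x y : PInj hI x = Some y -> S x y by move=> /hE[_ /fsg_rel]; exact: QS.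
by exists (BorelFsg hpre him hrel).
Qed.

Section LocalProduct.
Context (F : realType) d1 d2 (X : measurableType d1) (Y : measurableType d2).
Context (mu : probability X F) (nu : probability Y F) (R : cber X) (S : cber Y).
Hypothesis (mX : diag_measurable X) (mY : diag_measurable Y).

Lemma measurable_set1_diag d (Z : measurableType d) (z : Z) :
  diag_measurable Z -> measurable [set z].
Proof.
move=> mZ; have := measurable_xsec z mZ; congr measurable.
by apply/seteqP; split=> y /= /esym.
Qed.

Lemma pair1_image x (B : set Y) : measurable B ->
  measurable ((fun y => (x, y)) @` B : set (X * Y)).
Proof.
move=> mB; rewrite (_ : _ @` B = [set x] `*` B).
  by apply: measurableX => //; exact: measurable_set1_diag.
by apply/seteqP; split=> [_ [y By <-]//|[x' y] /= [-> By]]; exists y.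
Qed.

Lemma pair2_image y (B : set X) : measurable B ->
  measurable ((fun x => (x, y)) @` B : set (X * Y)).
Proof.
move=> mB; rewrite (_ : _ @` B = B `*` [set y]).
  by apply: measurableX => //; exact: measurable_set1_diag.
by apply/seteqP; split=> [_ [x Bx <-]//|[x y'] /= [Bx ->]]; exists x.
Qed.

(** Fixing the second coordinate of the argument to [y0], then the first to
    [x0], replaces each coordinate of [phi] by a function of one variable on a
    set of positive measure.  The second of these functions is the restriction
    of [phi] to a part of the line over [x0] that [phi] maps into another
    vertical line, so it is an element of the full semigroup of [S].  The first
    function is so far only Borel; it becomes injective once the second
    coordinate of its argument is fixed again, to [y1], inside the set where the
    second function is known. *)
Lemma locally_product (phi : borel_fsg (cber_prod R S)) (A : set (X * Y)) :
  measurable A -> A `<=` pdom phi -> 0 < pr (mu \x nu)%E A ->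
  exists (g : borel_fsg R) (h : borel_fsg S),
    0 < pr (mu \x nu)%E (A `&` [set p | phi p = borel_prod g h p]).
Proof.
move=> mA Adom Apos.
pose f1 p := (tot phi p).1; pose f2 p := (tot phi p).2.
have phiE p : A p -> phi p = Some (f1 p, f2 p).
  by move=> /Adom/(@pdom_tot _ phi) ->; rewrite /f1 /f2 -surjective_pairing.
have mtot := measurable_tot phi.
have mf1 : measurable_fun setT f1 by exact: (measurableT_comp measurable_fst mtot).
have mf2 : measurable_fun setT f2 by exact: (measurableT_comp measurable_snd mtot).
have rel p : A p -> R p.1 (f1 p) /\ S p.2 (f2 p) by move=> /phiE/fsg_rel.
have cf1 (B : set (X * Y)) x : B `<=` A -> countable (f1 @` [set p | B p /\ p.1 = x]).
  move=> BA; apply: sub_countable (cber_countable R x); apply: subset_card_le.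
  by move=> _ [p [/BA/rel[Rp _] <-] <-].
have cf2 (B : set (X * Y)) y : B `<=` A -> countable (f2 @` [set p | B p /\ p.2 = y]).
  move=> BA; apply: sub_countable (cber_countable S y); apply: subset_card_le.
  by move=> _ [p [/BA/rel[_ Sp] <-] <-].
have mcol B y : measurable B ->
    measurable [set p : X * Y | [/\ B p, B (p.1, y) & f1 p = f1 (p.1, y)]].
  move=> mB; have m2 : measurable_fun setT (fun p : X * Y => (p.1, y)).
    by apply: measurable_fun_pair => //; exact: measurable_fst.
  rewrite (_ : mkset _ = (B `&` (fun p => (p.1, y)) @^-1` B) `&`
      [set p | f1 p = f1 (p.1, y)]); last by apply/seteqP; split=> q [] //= [? ?] ?.
  apply: measurableI.
    by apply: measurableI => //; have := m2 measurableT _ mB; rewrite setTI.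
  by apply: measurable_eqfun => //; apply: measurableT_comp.
have mrow B x : measurable B ->
    measurable [set p : X * Y | [/\ B p, B (x, p.2) & f2 p = f2 (x, p.2)]].
  move=> mB; have m2 : measurable_fun setT (fun p : X * Y => (x, p.2)).
    by apply: measurable_fun_pair => //; exact: measurable_snd.
  rewrite (_ : mkset _ = (B `&` (fun p => (x, p.2)) @^-1` B) `&`
      [set p | f2 p = f2 (x, p.2)]); last by apply/seteqP; split=> q [] //= [? ?] ?.
  apply: measurableI.
    by apply: measurableI => //; have := m2 measurableT _ mB; rewrite setTI.
  by apply: measurable_eqfun => //; apply: measurableT_comp.
have [y0] := repeated_value mX mf1 mA (fun x => cf1 A x (fun _ => id)) Apos.
set A1 := (A1 in pr _ A1) => A1pos.
have mA1 : measurable A1 by exact: mcol.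
have A1A : A1 `<=` A by move=> p [].
have [x0] := repeated_value_swap mY mf2 mA1 (fun y => cf2 A1 y A1A) A1pos.
set A2 := (A2 in pr _ A2) => A2pos.
have mA2 : measurable A2 by exact: mrow.
have A2A1 : A2 `<=` A1 by move=> p [].
have A2A := subset_trans A2A1 A1A.
have [y1] := repeated_value mX mf1 mA2 (fun x => cf1 A2 x A2A) A2pos.
set A3 := (A3 in pr _ A3) => A3pos.
have mA3 : measurable A3 by exact: mcol.
have [h hE] : exists h : borel_fsg S, forall y y', h y = Some y' <->
    A1 (x0, y) /\ phi (x0, y) = Some (f1 (x0, y0), y').
  apply: (@slice_fsg _ _ _ _ (cber_prod R S) S phi (fun y => (x0, y))
    (fun y => (f1 (x0, y0), y)) [set y | A1 (x0, y)]) => //.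
  - by move=> y y' [].
  - by move=> y y' [].
  - exact: pair1_measurable.
  - exact: pair1_measurable.
  - exact: pair1_image.
  - exact: pair1_image.
  - by move=> y y' [].
  - exact: measurable_xsec.
have [g gE] : exists g : borel_fsg R, forall x x', g x = Some x' <->
    A2 (x, y1) /\ phi (x, y1) = Some (x', f2 (x0, y1)).
  apply: (@slice_fsg _ _ _ _ (cber_prod R S) R phi (fun x => (x, y1))
    (fun x => (x, f2 (x0, y1))) [set x | A2 (x, y1)]) => //.
  - by move=> x x' [].
  - by move=> x x' [].
  - exact: pair2_image.
  - exact: pair2_image.
  - by move=> x x' [].
  - exact: measurable_ysec.
exists g, h; apply: lt_le_trans A3pos _; apply: le_pr => //.
  by apply: measurableI => //; apply: measurable_eq; exact: diag_measurable_prod.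
move=> [x y] [A2xy /= A2xy1 f1y1]; split; first exact: A2A.
rewrite /= phiE; last exact: A2A.
have [_ /= A1x0y f2x0] := A2xy.
have [_ _ /= f2y1] := A2xy1.
have [_ _ /= f1x0] := A1x0y.
apply/esym/borel_prodP; split=> /=.
  by apply/gE; split=> //; rewrite phiE ?f2y1 -?f1y1//; exact: A2A.
by apply/hE; split=> //; rewrite phiE ?f1x0 -?f2x0//; exact: A1A.
Qed.

End LocalProduct.

(** * Exhaustion *)

Section Exhaustion.
Context (F : realType) d (T : measurableType d) (P : probability T F).

Lemma pr_bigcup_tail (A : nat -> set T) (eps : F) :
  (forall k, measurable (A k)) -> 0 < eps ->
  exists n, pr P (\bigcup_k A k `\` \bigcup_(k in `I_n) A k) < eps.
Proof.
move=> mA eps0; pose B n := \bigcup_k A k `\` \bigcup_(k in `I_n) A k.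
have mB n : measurable (B n).
  by apply: measurableD; exact: bigcup_measurable.
have B0 : \bigcap_n B n = set0.
  apply/seteqP; split=> x // Bx; have [[k _ Akx] _] := Bx 0%N Logic.I.
  have [_] := Bx k.+1 Logic.I; apply; exists k => //=.
have cvB : P \o B @ \oo --> P (\bigcap_n B n).
  apply: nonincreasing_cvg_mu => //.
  - exact: le_lt_trans (probability_le1 P (mB 0%N)) (ltry 1).
  - by rewrite B0.
  - move=> m n mn; apply/subsetPset => x [Ax nAx]; split=> // -[k /= km Akx].
    by apply: nAx; exists k => //=; exact: leq_trans mn.
rewrite B0 measure0 in cvB.
have [_ /cvgr_lt/(_ _ eps0)[n _ Hn]] := (fine_cvgP _ _).1 cvB.
by exists n; exact: (Hn n (leqnn n)).
Qed.

(** A sequence in the family whose union misses as little of [D] as possible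
    exists, since minimizing sequences can be merged; it misses a null set, as
    otherwise one more set of the family would improve it. *)
Lemma exhaustion (I : Type) (i0 : I) (D : set T) (E : I -> set T) (eps : F) :
  measurable D -> (forall i, measurable (E i)) ->
  (forall A, measurable A -> A `<=` D -> 0 < pr P A ->
     exists i, 0 < pr P (A `&` E i)) -> 0 < eps ->
  exists n (v : nat -> I), pr P (D `\` \bigcup_(k in `I_n) E (v k)) < eps.
Proof.
move=> mD mE hit eps0.
pose rest (v : nat -> I) := D `\` \bigcup_k E (v k).
have mU (v : nat -> I) n : measurable (\bigcup_(k in `I_n) E (v k)).
  exact: bigcup_measurable.
have mr v : measurable (rest v) by apply: measurableD => //; exact: bigcup_measurable.
pose V := [set pr P (rest v) | v in setT].
have lV : has_lbound V by exists 0 => _ [v _ <-]; exact: pr_ge0.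
have iV : has_inf V by split=> //; exists (pr P (rest (fun=> i0))); exists (fun=> i0).
have /choice[u uV] : forall n : nat, exists v, pr P (rest v) < inf V + n.+1%:R^-1.
  move=> n; have n0 : 0 < n.+1%:R^-1 :> F by [].
  by have [_ [v _ <-] vlt] := inf_adherent n0 iV; exists v.
(* the family [w] runs through all the families [u n] *)
pose w k := if unpickle k is Some (a, b) then u a b else i0.
have wu n : rest w `<=` rest (u n).
  move=> x [Dx nwx]; split=> // -[k _ Ek]; apply: nwx.
  by exists (pickle (n, k)) => //; rewrite /w pickleK.
have winf : pr P (rest w) <= inf V.
  apply/ler_addgt0Pr => e e0.
  have [n _ Hn] := near_infty_natSinv_lt (PosNum e0).
  apply: le_trans (le_pr P (mr w) (mr (u n)) (wu n)) _.
  by apply: le_trans (ltW (uV n)) _; rewrite lerD2l ltW//; exact: (Hn n (leqnn n)).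
have w0 : pr P (rest w) = 0.
  apply/eqP; rewrite eq_le pr_ge0 andbT leNgt; apply/negP => wpos.
  have [i ipos] := hit _ (mr w) (@subDsetl _ _ _) wpos.
  pose w' k := if k is k'.+1 then w k' else i.
  have : inf V <= pr P (rest w') by apply: ge_inf => //; exists w'.
  suff : pr P (rest w') <= pr P (rest w `\` E i).
    by move: winf ipos; rewrite [in X in X <= inf V -> _](pr_split P (mr w) (mE i)); lra.
  apply: le_pr => //; first exact: measurableD.
  move=> x [Dx nx]; split; last by move=> Ex; apply: nx; exists 0%N.
  by split=> // -[k _ Ek]; apply: nx; exists k.+1.
have [n nlt] := pr_bigcup_tail (fun k => mE (w k)) eps0.
exists n, w; apply: le_lt_trans nlt; rewrite -[leRHS]add0r -w0.
have mUw : measurable (\bigcup_k E (w k)) by exact: bigcup_measurable.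
apply: pr_subU => //; try exact: measurableD.
move=> x [Dx nx]; have [wx|nwx] := pselect ((\bigcup_k E (w k)) x); [by right|by left].
Qed.

End Exhaustion.

(** * The product relation preserves the product measure *)

Section ProductPreserving.
Context (F : realType) d1 d2 (X : measurableType d1) (Y : measurableType d2).
Context (mu : probability X F) (nu : probability Y F) (R : cber X) (S : cber Y).
Hypothesis (mX : diag_measurable X) (mY : diag_measurable Y).
Hypothesis (hR : measure_preserving mu R) (hS : measure_preserving nu S).
Let lam := (mu \x nu)%E.
Let mXY : diag_measurable (X * Y)%type := diag_measurable_prod mX mY.
Implicit Types phi : borel_fsg (cber_prod R S).

(** The product map is the composition of a map that moves points along vertical
    lines and one that moves them along horizontal lines, and each of these
    preserves the measure of all the sections in its direction. *)
Lemma pr_prod_image (g : borel_fsg R) (h : borel_fsg S) (A : set (X * Y)) :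
  measurable A -> A `<=` pdom (borel_prod g h) ->
  pr lam (pimage (borel_prod g h) A) = pr lam A.
Proof.
move=> mA Adom.
have domgh p : A p -> pdom g p.1 /\ pdom h p.2.
  by move=> /Adom/pdomP[q /borel_prodP[gp hp]]; split; apply/pdomP; eexists; eassumption.
pose B := pimage (borel_prod (borel_id R) h) A.
have mB : measurable B by exact: fsg_image.
have -> : pimage (borel_prod g h) A = pimage (borel_prod g (borel_id S)) B.
  apply/seteqP; split=> q.
    move=> [p Ap /borel_prodP[gp hp]]; exists (p.1, q.2).
      by exists p => //; apply/borel_prodP.
    exact/borel_prodP.
  move=> [p' [p Ap /borel_prodP[[p1] hp]] /borel_prodP[gp [p2]]].
  by exists p => //; apply/borel_prodP; rewrite p1 -p2.
transitivity (pr lam B).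
  apply: eq_pr_ysec => //; last exact: fsg_image.
  move=> y; have mBy := measurable_ysec y mB.
  rewrite (_ : mkset _ = pimage g [set x | B (x, y)]).
    rewrite /pr hR// => x [p Ap /borel_prodP[[/= <-] _]].
    by have [] := domgh _ Ap.
  apply/seteqP; split=> x.
    by move=> [[x' y'] Bp /borel_prodP[/= gx [yy]]]; exists x' => //=; rewrite -yy.
  by move=> [x' Bx gx]; exists (x', y) => //; exact/borel_prodP.
apply: eq_pr_xsec => // x; have mAx := measurable_xsec x mA.
rewrite (_ : mkset _ = pimage h [set y | A (x, y)]).
  by rewrite /pr hS// => y /domgh[].
apply/seteqP; split=> y.
  by move=> [[x' y'] Bp /borel_prodP[/= [xx] hy]]; exists y' => //=; rewrite -xx.
by move=> [y' Ay hy]; exists (x, y') => //; exact/borel_prodP.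
Qed.

Lemma exhaust_by_products phi (A : set (X * Y)) (eps : F) :
  measurable A -> A `<=` pdom phi -> 0 < eps ->
  exists n (v : nat -> borel_fsg R * borel_fsg S),
    pr lam (A `\` \bigcup_(k in `I_n) [set p | phi p = borel_prod (v k).1 (v k).2 p]) < eps.
Proof.
move=> mA Adom eps0.
apply: (exhaustion (borel_id R, borel_id S)
  (E := fun v => [set p | phi p = borel_prod v.1 v.2 p])) => //.
  by move=> i; exact: measurable_eq.
move=> B mB BA Bpos.
have [g [h pos]] := locally_product mX mY mB (subset_trans BA Adom) Bpos.
by exists (g, h).
Qed.

(** Up to a set of small measure, [A] splits into finitely many parts on which
    [phi] is a product map, and [phi] maps them to disjoint sets.  Only an
    inequality comes out directly, because nothing is known yet of the image of
    the remaining set; applied to the inverse of [phi] it gives [pr_image_le]. *)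
Lemma pr_image_ge phi A : measurable A -> A `<=` pdom phi ->
  pr lam A <= pr lam (pimage phi A).
Proof.
move=> mA Adom; apply/ler_addgt0Pr => eps eps0.
have [n [v vlt]] := exhaust_by_products mA Adom eps0.
have mE k : measurable [set p | phi p = borel_prod (v k).1 (v k).2 p].
  exact: measurable_eq.
have covered m B : measurable B -> B `<=` A ->
    B `<=` \bigcup_(k in `I_m) [set p | phi p = borel_prod (v k).1 (v k).2 p] ->
    pr lam B <= pr lam (pimage phi B).
  elim: m B => [|m IH] B mB BA Bcov.
    by rewrite (_ : B = set0) ?pr_set0 ?pr_ge0//; apply/seteqP; split=> x // /Bcov[].
  set E := [set p | phi p = borel_prod (v m).1 (v m).2 p].
  have mBE : measurable (B `&` E) by exact: measurableI (mE m).
  have mBD : measurable (B `\` E) by exact: measurableD (mE m).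
  have -> : pimage phi B = pimage phi (B `&` E) `|` pimage phi (B `\` E).
    apply/seteqP; split=> q; last by move=> [[p []]|[p []]]; exists p.
    move=> [p Bp pq]; have [Ep|nEp] := pselect (E p); [left|right]; by exists p.
  rewrite pr_setU; [|exact: fsg_image|exact: fsg_image|]; last first.
    apply/seteqP; split=> q // [[p [_ Ep] pq] [p' [_ nEp] pq']].
    by apply: nEp; rewrite -(pinjP pq pq').
  rewrite (pr_split lam mB (mE m)); apply: lerD.
    have -> : pimage phi (B `&` E) = pimage (borel_prod (v m).1 (v m).2) (B `&` E).
      by apply/seteqP; split=> q [p [Bp Ep] pq]; exists p => //; rewrite -pq// Ep.
    rewrite pr_prod_image// => p [/BA/Adom + Ep].
    by rewrite /pdom /= Ep.
  apply: IH => // p [Bp nEp]; first exact: BA.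
  have [k /= + Ek] := Bcov _ Bp; rewrite ltnS leq_eqVlt => /orP[/eqP km|km].
    by case: nEp; rewrite /E -km.
  by exists k.
set U := \bigcup_(k in `I_n) _ in vlt.
have mU : measurable U by exact: bigcup_measurable.
have mAU : measurable (A `&` U) by exact: measurableI.
rewrite (pr_split lam mA mU) lerD ?(ltW vlt)//.
apply: (@le_trans _ _ (pr lam (pimage phi (A `&` U)))).
  by apply: (covered n) => // p [].
apply: le_pr; [exact: fsg_image|exact: fsg_image|].
by move=> q [p [Ap _] pq]; exists p.
Qed.

Lemma pr_preimage_le phi B : measurable B -> pr lam (ppreimage phi B) <= pr lam B.
Proof.
move=> mB; have mP := fsg_preimage phi mB.
apply: le_trans (pr_image_ge (phi := phi) mP _) _.
  by move=> p /ppreimageP[q _ pq]; apply/pdomP; exists q.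
apply: le_pr => //; first exact: fsg_image.
by move=> q [p /ppreimageP[q' Bq' pq'] pq]; move: pq; rewrite pq' => -[<-].
Qed.

Lemma pr_image_le phi A : measurable A -> pr lam (pimage phi A) <= pr lam A.
Proof. by move=> mA; rewrite -ppreimage_inv; exact: (pr_preimage_le (borel_inv phi)). Qed.

End ProductPreserving.

(** * Approximation by finite unions of rectangles *)

Section RectangleApproximation.
Context (F : realType) d1 d2 (X : measurableType d1) (Y : measurableType d2).
Variable lam : probability (X * Y)%type F.
Implicit Types A B : set (X * Y).

(** Finite unions of rectangles are encoded by finite measurable partitions of
    both factors, which makes their stability under complement and union
    immediate. *)
Definition approximable A := measurable A /\ forall eps : F, 0 < eps ->
  exists (I J : finType) (f : X -> I) (k : Y -> J) (b : I -> J -> bool),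
  [/\ forall i, measurable [set x | f x = i],
      forall j, measurable [set y | k y = j] &
      pr lam (A `+` [set p | b (f p.1) (k p.2)]) < eps].

Lemma measurable_simple (I J : finType) (f : X -> I) (k : Y -> J) (b : I -> J -> bool) :
  (forall i, measurable [set x | f x = i]) ->
  (forall j, measurable [set y | k y = j]) ->
  measurable [set p : X * Y | b (f p.1) (k p.2)].
Proof.
move=> mf mk; apply: (@measurable_fibers _ _ _ (fun p => (f p.1, k p.2))
  (fun ij => b ij.1 ij.2)) => -[i j].
rewrite (_ : mkset _ = [set x | f x = i] `*` [set y | k y = j]).
  exact: measurableX.
by apply/seteqP; split=> p /= [-> ->].
Qed.

Lemma measurable_symdiff d (T : measurableType d) (A B : set T) :
  measurable A -> measurable B -> measurable (A `+` B).
Proof. by move=> mA mB; apply: measurableU; exact: measurableD. Qed.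

Lemma approximable0 : approximable set0.
Proof.
split=> // eps eps0.
exists unit, unit, (fun=> tt), (fun=> tt), (fun _ _ => false); split.
- by move=> i; rewrite (_ : mkset _ = setT)//; apply/seteqP; split=> x //= _; case: i.
- by move=> i; rewrite (_ : mkset _ = setT)//; apply/seteqP; split=> x //= _; case: i.
- by rewrite (_ : _ `+` _ = set0) ?pr_set0//; apply/seteqP; split=> x // -[[]|[]].
Qed.

Lemma approximableC A : approximable A -> approximable (~` A).
Proof.
move=> [mA aA]; split=> [|eps eps0]; first exact: measurableC.
have [I [J [f [k [b [mf mk lt]]]]]] := aA _ eps0.
exists I, J, f, k, (fun i j => ~~ b i j); split=> //.
rewrite (_ : _ `+` _ = A `+` [set p | b (f p.1) (k p.2)])//.
apply/seteqP; split=> p /= [[Ap]|[]] /=.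
- by move=> /negP/negPn bp; right.
- by move=> /negP bp /contrapT Ap; left.
- by move=> nb; right; split; [exact/negP|apply].
- by move=> bp nA; left; split=> //; apply/negP/negPn.
Qed.

Lemma approximableU A B : approximable A -> approximable B -> approximable (A `|` B).
Proof.
move=> [mA aA] [mB aB]; split=> [|eps eps0]; first exact: measurableU.
have e0 : 0 < eps / 2 by rewrite divr_gt0.
have [I [J [f [k [b [mf mk lt]]]]]] := aA _ e0.
have [I' [J' [f' [k' [b' [mf' mk' lt']]]]]] := aB _ e0.
exists (I * I')%type, (J * J')%type, (fun x => (f x, f' x)), (fun y => (k y, k' y)),
  (fun i j => b i.1 j.1 || b' i.2 j.2).
have mff (T : Type) (T1 T2 : finType) (u : T -> T1) (u' : T -> T2) i i' :
   [set x | (u x, u' x) = (i, i')] = [set x | u x = i] `&` [set x | u' x = i'].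
  by apply/seteqP; split=> x [] /= -> ->.
have mf2 i : measurable [set x | (f x, f' x) = i].
  by case: i => i i'; rewrite mff; exact: measurableI.
have mk2 i : measurable [set y | (k y, k' y) = i].
  by case: i => i i'; rewrite mff; exact: measurableI.
split=> //; rewrite [ltRHS]splitr; apply: le_lt_trans (ltrD lt lt').
have ms := measurable_simple b mf mk; have ms' := measurable_simple b' mf' mk'.
apply: pr_subU; [|exact: measurable_symdiff|exact: measurable_symdiff|].
  apply: measurable_symdiff; first exact: measurableU.
  exact: (measurable_simple (fun i j => b i.1 j.1 || b' i.2 j.2) mf2 mk2).
move=> p /= [[[Ap|Bp] /negP]|[/orP[bp|bp]]]; rewrite /setY /setD /=.
- by rewrite negb_or => /andP[/negP ? _]; left; left.
- by rewrite negb_or => /andP[_ /negP ?]; right; left.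
- by move=> nAB; left; right; split=> // Ap; apply: nAB; left.
- by move=> nAB; right; right; split=> // Bp; apply: nAB; right.
Qed.

Lemma approximable_bigcup (A : nat -> set (X * Y)) :
  (forall n, approximable (A n)) -> approximable (\bigcup_n A n).
Proof.
move=> aA; have mA n : measurable (A n) by case: (aA n).
have mU : measurable (\bigcup_n A n) by exact: bigcup_measurable.
split=> // eps eps0; have e0 : 0 < eps / 2 by rewrite divr_gt0.
have [n nlt] := pr_bigcup_tail lam mA e0.
have mUn : measurable (\bigcup_(k in `I_n) A k) by exact: bigcup_measurable.
have [_ /(_ _ e0)] : approximable (\bigcup_(k in `I_n) A k).
  elim: (n) => [|m IH]; first by rewrite II0 bigcup_set0; exact: approximable0.
  by rewrite IIS bigcup_setU bigcup_set1; exact: approximableU.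
move=> [I [J [f [k [b [mf mk lt]]]]]].
exists I, J, f, k, b; split=> //.
rewrite [ltRHS]splitr; apply: le_lt_trans (ltrD nlt lt).
have ms := measurable_simple b mf mk.
apply: pr_subU; [exact: measurable_symdiff|exact: measurableD|exact: measurable_symdiff|].
move=> p [[Ap nb]|[bp nA]].
  have [An|nAn] := pselect ((\bigcup_(k in `I_n) A k) p); last by left.
  by right; left.
by right; right; split=> // -[j _ Aj]; apply: nA; exists j.
Qed.

Lemma measurable_approximable A : measurable A -> approximable A.
Proof.
rewrite measurable_prod_measurableType; move: A; apply: smallest_sub.
  split; first exact: approximable0.
  - by move=> A aA; rewrite setTD; exact: approximableC.
  - exact: approximable_bigcup.
move=> _ [A mA [B mB <-]]; split=> [|eps eps0]; first exact: measurableX.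
exists bool, bool, (fun x => `[< A x >]), (fun y => `[< B y >]), andb.
have mb d (T : measurableType d) (C : set T) i : measurable C ->
    measurable [set x | `[< C x >] = i].
  move=> mC; case: i.
    by rewrite (_ : mkset _ = C)//; apply/seteqP; split=> x /= /asboolP.
  rewrite (_ : mkset _ = ~` C); first exact: measurableC.
  apply/seteqP; split=> x /=; first by move=> /negbT/asboolPn.
  by move=> nC; apply/negbTE/asboolPn.
split; [by move=> i; exact: mb|by move=> i; exact: mb|].
rewrite (_ : _ `+` _ = set0) ?pr_set0//; apply/seteqP; split=> x //=.
move=> [[[Ax Bx] /negP]|[/andP[/asboolP Ax /asboolP Bx]]]; last by apply.
by rewrite negb_and => /orP[] /asboolPn.
Qed.

End RectangleApproximation.

(** * Finite families of rectangular pieces *)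

Section Pieces.
Context (F : realType) d1 d2 (X : measurableType d1) (Y : measurableType d2).
Context (mu : probability X F) (nu : probability Y F) (R : cber X) (S : cber Y).
Hypothesis (mX : diag_measurable X) (mY : diag_measurable Y).
Hypothesis (hR : measure_preserving mu R) (hS : measure_preserving nu S).
Let lam := (mu \x nu)%E.
Let mXY : diag_measurable (X * Y)%type := diag_measurable_prod mX mY.
Implicit Types phi : borel_fsg (cber_prod R S).

(** The pieces may overlap, and outside [G] they may disagree with each other and
    with [phi].  The first condition makes their union single-valued on [G], and
    the last one makes it injective even with respect to the points outside
    [G]. *)
Definition pieces_of phi (D G : set (X * Y)) (I : finType) (g : I -> borel_fsg R)
    (h : I -> borel_fsg S) : Prop :=
  [/\ forall z i q, G z -> borel_prod (g i) (h i) z = Some q -> phi z = Some q,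
      forall z, G z -> D z -> exists i q, borel_prod (g i) (h i) z = Some q &
      forall z i p q, G z -> phi z = Some q -> borel_prod (g i) (h i) p = Some q -> p = z].

(** The domain [A] of agreement is approximated by a union [A'] of rectangles, to
    which [g x h] is restricted.  Besides the points where [A] and [A'] differ,
    [G] has to avoid the points whose image by [phi] is also the image by [g x h]
    of a point of [A'] outside [A]; they form a set of small measure because all
    the maps involved preserve the measure. *)
Lemma pieces_of_one phi (g : borel_fsg R) (h : borel_fsg S) (eps : F) : 0 < eps ->
  exists (G : set (X * Y)) (I : finType) (g' : I -> borel_fsg R) (h' : I -> borel_fsg S),
  [/\ measurable G, pr lam (~` G) < eps &
      pieces_of phi (pdom phi `&` [set p | phi p = borel_prod g h p]) G g' h'].
Proof.
move=> eps0; set A := pdom phi `&` _.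
have mA : measurable A.
  by apply: measurableI; [exact: measurable_pdom|exact: measurable_eq].
have e0 : 0 < eps / 2 by rewrite divr_gt0.
have [_ /(_ _ e0)[I [J [f [k [b [mf mk]]]]]]] := measurable_approximable lam mA.
set A' := [set p | b _ _] => lt.
have mA' : measurable A' := measurable_simple b mf mk.
have mAA' : measurable (A `+` A') by exact: measurable_symdiff.
have mD : measurable (A' `\` A) by exact: measurableD.
pose B := ppreimage phi (pimage (borel_prod g h) (A' `\` A)).
have mB : measurable B by apply: fsg_preimage; exact: fsg_image.
pose g' (ij : I * J) := if b ij.1 ij.2 then borel_comp g (borel_on R (mf ij.1))
  else borel_empty R.
pose h' (ij : I * J) := borel_comp h (borel_on S (mk ij.2)).
have pieceE ij p q : borel_prod (g' ij) (h' ij) p = Some q <->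
    [/\ b ij.1 ij.2, f p.1 = ij.1, k p.2 = ij.2 & borel_prod g h p = Some q].
  rewrite !borel_prodP /g' /h'.
  case bij: (b ij.1 ij.2); last by split=> -[].
  have onE T (W : set T) (u : pinj T) x y :
      pinj_comp u (pinj_on W) x = Some y <-> W x /\ u x = Some y.
    rewrite pcompE; have [Wx|nWx] := pselect (W x); first by rewrite pinj_onT//; split=> // -[].
    by rewrite pinj_onF//; split=> // -[].
  rewrite !onE /=; split; first by move=> [[? ?] [? ?]]; split=> //; apply/borel_prodP.
  by move=> [_ ? ?] /borel_prodP[? ?].
exists (~` ((A `+` A') `|` B)), (I * J)%type, g', h'; split.
- by apply: measurableC; exact: measurableU.
- rewrite setCK [ltRHS]splitr; apply: le_lt_trans (ltrD lt lt).
  apply: le_trans (pr_setU_le _ mAA' mB) _; rewrite lerD2l.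
  apply: le_trans (pr_preimage_le mX mY hR hS phi (fsg_image _ mD)) _.
  apply: le_trans (pr_image_le mX mY hR hS (borel_prod g h) mD) _.
  by apply: le_pr => // p [A'p nAp]; right.
split.
- move=> z ij q nG /pieceE[bij fz kz ghz].
  have A'z : A' z by rewrite /A' /= fz kz.
  have [[_ /= ->]//|nAz] := pselect (A z).
  by case: nG; left; right.
- move=> z nG Az; have A'z : A' z by apply: contrapT => ?; apply: nG; left; left.
  have [/pdomP[q pq] ghz] := Az.
  by exists (f z.1, k z.2), q; apply/pieceE; split=> //; rewrite -ghz.
- move=> z ij p q nG pz /pieceE[bij fp kp ghp].
  have A'p : A' p by rewrite /A' /= fp kp.
  have [[_ /= php]|nAp] := pselect (A p).
    by apply: (pinjP _ pz); rewrite php.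
  case: nG; right; apply/ppreimageP; exists q => //; by exists p.
Qed.

Lemma exists_pieces phi (eps : F) : 0 < eps ->
  exists (G : set (X * Y)) (I : finType) (g : I -> borel_fsg R) (h : I -> borel_fsg S),
  [/\ measurable G, pr lam (~` G) < eps & pieces_of phi (pdom phi) G g h].
Proof.
move=> eps0; have e0 : 0 < eps / 2 by rewrite divr_gt0.
have mdom := measurable_pdom phi.
have [n [v vlt]] := exhaust_by_products mu nu mX mY mdom (fun _ => id) e0.
pose E k := [set p | phi p = borel_prod (v k).1 (v k).2 p].
have [G [I [g [h [mG Glt [P1 P2 P3]]]]]] : exists (G : set (X * Y)) (I : finType)
    (g : I -> borel_fsg R) (h : I -> borel_fsg S), [/\ measurable G, pr lam (~` G) < eps / 2 &
      pieces_of phi (pdom phi `&` \bigcup_(k in `I_n) E k) G g h].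
  elim: (n) (eps / 2) e0 => [|m IH] e e0.
    exists setT, void, (of_void _), (of_void _).
    split=> //; first by rewrite setCT pr_set0.
    by split=> [z []|z _ [_ []]|z []].
  have e20 : 0 < e / 2 by rewrite divr_gt0.
  have [G [I [g [h [mG Glt [P1 P2 P3]]]]]] := IH _ e20.
  have [G' [I' [g' [h' [mG' Glt' [P1' P2' P3']]]]]] :=
    pieces_of_one phi (v m).1 (v m).2 e20.
  exists (G `&` G'), (I + I')%type,
    (fun i => match i with inl i => g i | inr i => g' i end),
    (fun i => match i with inl i => h i | inr i => h' i end).
  split; first exact: measurableI.
    rewrite setCI [ltRHS]splitr; apply: le_lt_trans (ltrD Glt Glt').
    by apply: pr_setU_le; exact: measurableC.
  split.
  - by move=> z [i|i] q [Gz G'z]; [exact: P1|exact: P1'].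
  - move=> z [Gz G'z] [dz [k /= + Ek]]; rewrite ltnS leq_eqVlt => /orP[/eqP km|km].
      have [|i [q iq]] := P2' z G'z; last by exists (inr i), q.
      by split=> //; rewrite -km.
    have [|i [q iq]] := P2 z Gz; last by exists (inl i), q.
    by split=> //; exists k.
  - by move=> z [i|i] p q [Gz G'z]; [exact: P3|exact: P3'].
have mE k : measurable (E k) by exact: measurable_eq.
set D := pdom phi `\` _ in vlt.
have mD : measurable D.
  by apply: measurableD => //; apply: bigcup_measurable => k _; exact: mE.
exists (G `\` D), I, g, h; split; first exact: measurableD.
  rewrite [ltRHS]splitr; apply: le_lt_trans (ltrD Glt vlt).
  apply: (pr_subU lam (measurableC (measurableD mG mD)) (measurableC mG) mD).
  move=> z nz; have [Dz|nDz] := pselect (D z); first by right.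
  by left=> Gz; apply: nz.
split.
- by move=> z i q [Gz _]; exact: P1.
- move=> z [Gz nDz] dz; apply: P2 => //; split=> //.
  by apply: contrapT => nz; apply: nDz.
- by move=> z i p q [Gz _]; exact: P3.
Qed.

End Pieces.

(** * Local types *)

(** A finite alphabet for the identity, the empty map, the elements of a family
    indexed by [J] and their inverses. *)
Definition letter (J : finType) : finType := (bool * option J)%type.

Definition spell d (X : measurableType d) (R : cber X) (J : finType)
    (g : J -> borel_fsg R) (l : letter J) : borel_fsg R :=
  match l with
  | (true, None) => borel_id R
  | (false, None) => borel_empty R
  | (true, Some j) => g j
  | (false, Some j) => borel_inv (g j)
  end.

(** Undefined values count as equal, so that comparing with the empty map detects
    domains.  Words of length two suffice to compare the composition of two pieces
    with a third one and to test whether one letter inverts another. *)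
Definition ltype (L : finType) T (rho : L -> T -> option T) (x : T) :
    {ffun L * L * L -> bool} :=
  [ffun w => `[< pcomp (rho w.1.1) (rho w.1.2) x = rho w.2 x >]].

Lemma ltypeP (L : finType) T (rho : L -> T -> option T) (x : T) u v w :
  reflect (pcomp (rho u) (rho v) x = rho w x) (ltype rho x (u, v, w)).
Proof. by rewrite ffunE; exact: asboolP. Qed.

Definition matches_local_types (F : realType) d (X : measurableType d)
    (mu : probability X F) (R : cber X) : Prop :=
  forall (J : finType) (g : J -> borel_fsg R) (eps : F), 0 < eps ->
  exists (N : nat) (rho : letter J -> pinj 'I_N),
  [/\ (0 < N)%N, rho (true, None) = pinj_id 'I_N, rho (false, None) = pinj_empty 'I_N &
      forall t, pr mu [set x | ltype (spell g) x = t] <=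
                cnt F [set m | ltype rho m = t] + eps].

Lemma finite_enum T (A : set T) : finite_set A ->
  exists n (k : 'I_n -> T), A `<=` range k.
Proof.
move=> finA; have [s sE] := (@finite_seqP {classic T} A).1 finA.
exists (size s), (tnth (in_tuple s)) => x; rewrite sE /= => xs.
have xs' : (index (x : {classic T}) s < size s)%N by rewrite index_mem.
by exists (Ordinal xs') => //; rewrite (tnth_nth (x : {classic T})) /= nth_index.
Qed.

Lemma mu_countE (F : realType) N (A : set 'I_N) : mu_count F A = cnt F A.
Proof. by rewrite /mu_count /cnt card_ord. Qed.

(** The two terms of the distance correspond to the points where exactly one of
    the maps is undefined and to those where both are defined; comparing values
    in the option type accounts for both. *)
Lemma d_countE (F : realType) N (f g : pinj 'I_N) :
  d_count F f g = cnt F [set m | f m <> g m].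
Proof.
rewrite /d_count /pdist !mu_countE -cnt_disjU.
  congr (cnt F _); apply/seteqP; split=> m /=; rewrite /pdom /setD /=.
    by case: (f m) (g m) => [y|] [z|] //= [[[]|[]]|[[]]].
  by case: (f m) (g m) => [y|] [z|] //= ?; [right|left;left|left;right].
by apply/seteqP; split=> m //= [[[? ?]|[? ?]]] [[]].
Qed.

Section SoficTypes.
Context (F : realType) d (X : measurableType d) (mu : probability X F) (R : cber X).
Hypothesis mX : diag_measurable X.

Lemma measurable_ltype (J : finType) (g : J -> borel_fsg R) t :
  measurable [set x | ltype (spell g) x = t].
Proof.
rewrite (_ : mkset _ = ~` [set x | exists w, [set x | ltype (spell g) x w != t w] x]).
  apply/measurableC/measurable_fin => -[[u v] w].
  have mE := measurable_eq (borel_comp (spell g u) (spell g v)) (spell g w) mX.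
  case: (t _).
    rewrite (_ : mkset _ = ~` [set x | borel_comp (spell g u) (spell g v) x = spell g w x]).
      exact: measurableC.
    apply/seteqP; split=> x /=; rewrite eqb_id; first by move=> /negP nE ?; apply/nE/ltypeP.
    by move=> nE; apply/negP => /ltypeP.
  rewrite (_ : mkset _ = [set x | borel_comp (spell g u) (spell g v) x = spell g w x])//.
  by apply/seteqP; split=> x /=; rewrite eqbF_neg negbK;
    [move=> /ltypeP|move=> ?; apply/ltypeP].
apply/seteqP; split=> x /=; first by move=> <- [w]; rewrite eqxx.
by move=> nt; apply/ffunP => w; apply/eqP/negPn/negP => ntw; apply: nt; exists w.
Qed.

Definition generate (P : set (borel_fsg R)) : set (borel_fsg R) :=
  P `|` (@borel_inv _ _ R @` P) `|` [set borel_comp a b | a in P & b in P].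

Lemma generate_finite P : finite_set P -> finite_set (generate P).
Proof.
move=> finP; rewrite !finite_setU; split; last exact: finite_image2.
by split=> //; exact: finite_image.
Qed.

(** The restriction [a] of a product of letters to the points of local type [t]
    is either empty or has [e t], the identity of that set, as its source.  An
    approximation that respects these relations, away from a small set of
    points, therefore sends the fixed points of the image of [e t] to points
    whose local type satisfies the equalities in [t].  The inequalities in [t]
    hold there as well because an element without fixed points has an image
    with few fixed points. *)
Lemma sofic_matches_local_types : sofic mu R -> matches_local_types mu R.
Proof.
move=> sof J g eps eps0.
pose L := letter J; pose T := {ffun L * L * L -> bool}.
pose E (t : T) := [set x | ltype (spell g) x = t].
have mE t : measurable (E t) by exact: measurable_ltype.
pose e t := borel_on R (mE t).
(* two rounds produce products of two letters with some [e t], the third one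
   their inverses and the fourth one products of these with the former *)
pose P0 := range (spell g) `|` range e.
pose P1 := generate P0; pose P2 := generate P1.
pose P3 := generate P2; pose P4 := generate P3.
have finP4 : finite_set P4.
  do 4 apply: generate_finite.
  by rewrite finite_setU; split; apply: finite_image; exact: finite_finset.
have [n [k Pk]] := finite_enum finP4.
have genS P : P `<=` generate P by move=> a Pa; left; left.
have genM P a b : P a -> P b -> generate P (borel_comp a b).
  by move=> Pa Pb; right; exists a => //; exists b.
have genV P a : P a -> generate P (borel_inv a) by move=> Pa; left; right; exists a.
(* [n * n] errors from products, [n] from fixed points, one for [e t] *)
pose c : F := n%:R * n%:R + n%:R + 1.
have c0 : 0 < c by rewrite /c ltr_wpDl// addr_ge0// mulr_ge0.
have eps0' : 0 < eps / c by rewrite divr_gt0.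
have [N [pi [N0 [pi_id pi_empty pi_comp pi_fix]]]] :=
  sof _ _ (finite_image (fun a => fsg_of mu a) (finite_image k (@finite_finset _ [set: 'I_n]))) eps0'.
pose p a := pi (fsg_of mu a).
have p_ext (a b : borel_fsg R) : a =1 b -> p a = p b by move=> ab; rewrite /p (fsg_of_ext mu ab).
have Kk i : [set fsg_of mu a | a in range k] (fsg_of mu (k i)).
  by exists (k i) => //; exists i.
pose bad1 m := exists ij : 'I_n * 'I_n,
  p (borel_comp (k ij.1) (k ij.2)) m <> pinj_comp (p (k ij.1)) (p (k ij.2)) m.
pose bad2 m := exists i : 'I_n, pr mu (pfix (k i)) = 0 /\ p (k i) m = Some m.
have bad1_le : cnt F bad1 <= n%:R * n%:R * (eps / c).
  apply: le_trans (cnt_fin_le F (B := fun ij => [set m | p (borel_comp (k ij.1) (k ij.2)) m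
     <> pinj_comp (p (k ij.1)) (p (k ij.2)) m]) _) _ => //.
  apply: (@le_trans _ _ (\sum_(ij : 'I_n * 'I_n) eps / c)).
    by apply: ler_sum => ij _; rewrite -d_countE ltW//; exact: pi_comp.
  by rewrite sumr_const card_prod card_ord -natrM mulr_natl.
have bad2_le : cnt F bad2 <= n%:R * (eps / c).
  apply: le_trans (cnt_fin_le F (B := fun i => [set m | pr mu (pfix (k i)) = 0
    /\ p (k i) m = Some m]) _) _ => //.
  apply: (@le_trans _ _ (\sum_(i : 'I_n) eps / c)).
    apply: ler_sum => i _; have [fix0|fixn0] := pselect (pr mu (pfix (k i)) = 0).
      apply: (@le_trans _ _ (cnt F (pfix (p (k i))))); first by apply: le_cnt => m [].
      have := pi_fix _ (Kk i).
      have -> : fine (mu (pfix (k i))) = 0 by [].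
      by rewrite sub0r normrN mu_countE ger0_norm ?cnt_ge0// => /ltW.
    rewrite (_ : mkset _ = set0) ?cnt_set0; first exact: ltW.
    by apply/seteqP; split=> m // -[].
  by rewrite sumr_const card_ord mulr_natl.
exists N, (fun l => p (spell g l)); split=> // t.
suff sub : pfix (p (e t)) `<=`
    [set m | ltype (fun l => p (spell g l)) m = t] `|` (bad1 `|` bad2).
  have := cnt_subU F sub; have := cnt_setU_le F bad1 bad2.
  have -> : [set x | ltype (spell g) x = t] = pfix (e t).
    apply/seteqP; split=> x; first by move=> Ex; apply/pinj_onP.
    by move=> /pinj_onP[].
  have P4e : P4 (e t) by do 4 apply: (genS); right; exists t.
  have [i _ ki] := Pk _ P4e.
  have := pi_fix _ (Kk i); rewrite ki mu_countE -/(pr mu (pfix (e t))).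
  rewrite ltr_distl => /andP[_ lt1].
  have cE : n%:R * n%:R * (eps / c) + n%:R * (eps / c) + eps / c = eps.
    rewrite -!mulrDl -[X in _ + X]mul1r -mulrDl -/c mulrC divfK//; exact: lt0r_neq0.
  move: bad1_le bad2_le lt1 cE.
  rewrite -/(p (e t)); lra.
move=> m /= em; have [b1|nb1] := pselect (bad1 m); first by right; left.
have [b2|nb2] := pselect (bad2 m); first by right; right.
left; have pM a b : P4 a -> P4 b -> p (borel_comp a b) m = pinj_comp (p a) (p b) m.
  move=> /Pk[i _ <-] /Pk[j _ <-]; apply: contrapT => nij; apply: nb1.
  by exists (i, j).
have pF a : P4 a -> pr mu (pfix a) = 0 -> p a m <> Some m.
  by move=> /Pk[i _ <-] fix0 pa; apply: nb2; exists i.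
have pE : p (borel_empty R) = pinj_empty 'I_N by rewrite /p pi_empty.
have pE1 : p (borel_id R) = pinj_id 'I_N by rewrite /p pi_id.
have [x0 Ex0] : exists x, E t x.
  apply: contrapT => nE; have : p (e t) m = None.
    rewrite (p_ext (e t) (borel_empty R)) ?pE// => x.
    by apply: pinj_onF => Ex; apply: nE; exists x.
  by rewrite em.
pose a u v := borel_comp (spell g u) (borel_comp (spell g v) (e t)).
have P0l l : P0 (spell g l) by left; exists l.
have P0e : P0 (e t) by right; exists t.
have P2a u v : P2 (a u v) by apply: (genM); [exact: (genS)|exact: (genM)].
have aE u v x : E t x -> a u v x = pcomp (spell g u) (spell g v) x.
  by move=> Ex; rewrite -[LHS]/(obind _ (obind (spell g v) (e t x))) pinj_onT.
have aN u v x : ~ E t x -> a u v x = None.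
  by move=> Ex; rewrite -[LHS]/(obind (spell g u) (obind (spell g v) (e t x))) pinj_onF.
have ltE x u v w : E t x -> t (u, v, w) ->
    pcomp (spell g u) (spell g v) x = spell g w x.
  by move=> <- /ltypeP.
have ltN x u v w : E t x -> ~~ t (u, v, w) ->
    pcomp (spell g u) (spell g v) x <> spell g w x.
  by move=> <- /negP ntw ?; apply: ntw; apply/ltypeP.
pose none : L := (false, None); pose one : L := (true, None).
have pa u v : p (a u v) m = pcomp (p (spell g u)) (p (spell g v)) m.
  rewrite pM; [|by do 4 apply: (genS)|by do 3 apply: (genS); exact: (genM)].
  rewrite /= /pcomp /= pM; [|by do 4 apply: (genS)|by do 4 apply: (genS)].
  by rewrite /= /pcomp em.
have pa_one w : p (a one w) m = p (spell g w) m.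
  by rewrite pa pE1 /pcomp /=; case: (p _ m).
have a_none u v : t (u, v, none) -> p (a u v) m = None.
  move=> tn; rewrite (p_ext (a u v) (borel_empty R)) ?pE// => x.
  by have [Ex|nEx] := pselect (E t x); [rewrite aE// (ltE _ _ _ _ Ex tn)|rewrite aN].
have a_total u v : ~~ t (u, v, none) ->
    pcomp (p (borel_inv (a u v))) (p (a u v)) m = Some m.
  move=> tn; rewrite -[LHS]pM; [|by apply/genS/genV|by do 2 apply: (genS)].
  rewrite (p_ext _ (e t)) // => x; apply: option_ext => y.
  rewrite [borel_comp _ _ x]pcompE; split; last first.
    move=> /pinj_onP[Ex <-]; have := ltN _ _ _ _ Ex tn; rewrite -aE//.
    case axy: (a u v x) => [y'|//] _; exact/borel_invP.
  case axy: (a u v x) => [y'|//] /borel_invP/(pinjP axy) <-.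
  apply: pinj_onT; apply: contrapT => nEx; by rewrite aN in axy.
apply/ffunP => -[[u v] w]; case tw: (t (u, v, w)).
  apply/ltypeP; rewrite -pa -pa_one; congr (_ m); congr pfun; apply: p_ext => x.
  have [Ex|nEx] := pselect (E t x); last by rewrite !aN.
  rewrite !aE// (ltE _ _ _ _ Ex tw) /pcomp /=; by case: (spell g w x).
apply/negP => /ltypeP; rewrite -pa -pa_one => pab.
have [nuv|tuv] := boolP (t (u, v, none)).
  have [nw|tw'] := boolP (t (one, w, none)).
    have := ltN _ _ _ _ Ex0 (negbT tw); apply.
    rewrite (ltE _ _ _ _ Ex0 nuv) /=; have := ltE _ _ _ _ Ex0 nw.
    by rewrite /pcomp /=; case: (spell g w x0).
  by have := a_total _ _ tw'; rewrite /pcomp -pab a_none.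
have [nw|tw'] := boolP (t (one, w, none)).
  by have := a_total _ _ tuv; rewrite /pcomp pab a_none.
have := a_total _ _ tw'; rewrite /pcomp -pab -[obind _ _]/(pcomp _ _ m).
rewrite -[LHS]pM; [|by apply/genS/genV|by do 2 apply: (genS)].
apply: pF; first by apply: (genM); [exact: (genV)|exact: (genS)].
rewrite (_ : pfix _ = set0) ?pr_set0//; apply/seteqP; split=> x // fx.
move: (fx : borel_comp _ _ x = Some x); rewrite [borel_comp _ _ x]pcompE.
case axy: (a u v x) => [y|//] /borel_invP bxy.
have Ex : E t x by apply: contrapT => nEx; rewrite aN in axy.
have := ltN _ _ _ _ Ex (negbT tw); apply; rewrite -aE// axy -bxy aE//.
by rewrite /pcomp /=; case: (spell g w x).
Qed.

End SoficTypes.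

(** * Approximations of the product relation *)

(** One-sided bounds on the frequencies of the single values suffice in the
    hypotheses because all the frequencies add up to 1: the upper bound for [Q]
    comes from the lower bounds for the values outside [Q]. *)
Lemma joint_statistics (F : realType) d1 d2 (X : measurableType d1)
    (Y : measurableType d2) (mu : probability X F) (nu : probability Y F)
    (M N T1 T2 : finType) (f1 : X -> T1) (f2 : Y -> T2) (k1 : M -> T1) (k2 : N -> T2)
    (eps : F) :
  (0 < #|M|)%N -> (0 < #|N|)%N -> 0 <= eps ->
  (forall s, measurable [set x | f1 x = s]) -> (forall t, measurable [set y | f2 y = t]) ->
  (forall s, pr mu [set x | f1 x = s] <= cnt F [set x | k1 x = s] + eps) ->
  (forall t, pr nu [set y | f2 y = t] <= cnt F [set y | k2 y = t] + eps) ->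
  forall Q : T1 -> T2 -> bool,
  cnt F [set p : M * N | Q (k1 p.1) (k2 p.2)] <=
  pr (mu \x nu)%E [set p | Q (f1 p.1) (f2 p.2)] + 2 * eps * #|{: T1 * T2}|%:R.
Proof.
move=> M0 N0 eps0 mf1 mf2 le1 le2 Q.
pose f (p : X * Y) := (f1 p.1, f2 p.2); pose k (p : M * N) := (k1 p.1, k2 p.2).
have fE s t : [set p | f p = (s, t)] = [set x | f1 x = s] `*` [set y | f2 y = t].
  by apply/seteqP; split=> p /= => [[-> ->]|[<- <-]].
have kE s t : [set p | k p = (s, t)] = [set x | k1 x = s] `*` [set y | k2 y = t].
  by apply/seteqP; split=> p /= => [[-> ->]|[<- <-]].
have mf st : measurable [set p | f p = st].
  by case: st => s t; rewrite fE; exact: measurableX.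
have le st : pr (mu \x nu)%E [set p | f p = st] <= cnt F [set p | k p = st] + 2 * eps.
  case: st => s t; rewrite fE kE pr_prod// cnt_setX.
  have a0 := pr_ge0 mu [set x | f1 x = s]; have a1 := pr_le1 mu (mf1 s).
  have b0 := pr_ge0 nu [set y | f2 y = t]; have b1 := pr_le1 nu (mf2 t).
  have c0 := cnt_ge0 F [set x | k1 x = s]; have d0 := cnt_ge0 F [set y | k2 y = t].
  have c1 : cnt F [set x | k1 x = s] <= 1.
    by rewrite -(cnt_setT F M0); exact: le_cnt.
  apply: (@le_trans _ _ ((cnt F [set x | k1 x = s] + eps) * pr nu [set y | f2 y = t])).
    exact: ler_wpM2r.
  rewrite mulrDl; apply: (@le_trans _ _ (cnt F [set x | k1 x = s] *
      (cnt F [set y | k2 y = t] + eps) + eps * 1)).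
    by apply: lerD; exact: ler_wpM2l.
  by rewrite mulrDr mulr1 -addrA lerD2l mulrDl mul1r lerD2r ler_piMl.
have compl : pr (mu \x nu)%E [set p | ~~ Q (f p).1 (f p).2] <=
    cnt F [set p | ~~ Q (k p).1 (k p).2] + 2 * eps * #|{: T1 * T2}|%:R.
  rewrite (@pr_fibers _ _ _ (mu \x nu)%E _ f (fun st => ~~ Q st.1 st.2))//.
  rewrite (@cnt_fibers _ _ _ k (fun st => ~~ Q st.1 st.2)).
  apply: le_trans (ler_sum _ (fun st _ => le st)) _.
  rewrite big_split/= lerD2l sumr_const -[leLHS]mulr_natr.
  by apply: ler_wpM2l; [rewrite mulr_ge0|rewrite ler_nat max_card].
have mQ : measurable [set p | Q (f p).1 (f p).2].
  exact: (measurable_fibers (fun st => Q st.1 st.2) mf).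
have := pr_setC (mu \x nu)%E mQ.
have -> : ~` [set p | Q (f p).1 (f p).2] = [set p | ~~ Q (f p).1 (f p).2].
  by apply/seteqP; split=> p /= /negP.
have MN0 : (0 < #|{: M * N}|)%N by rewrite card_prod muln_gt0 M0.
have : cnt F [set p | Q (k p).1 (k p).2] + cnt F [set p | ~~ Q (k p).1 (k p).2] = 1.
  rewrite -cnt_disjU -?(cnt_setT F MN0).
    congr (cnt F _); apply/seteqP; split=> p //= _.
    by case: (Q _ _); [left|right].
  by apply/seteqP; split=> p //= [->].
move: compl; rewrite /f /k /=; lra.
Qed.

Lemma cnt_ppreimage_le (F : realType) (T : finType) (f : pinj T) (B : set T) :
  cnt F (ppreimage f B) <= cnt F B.
Proof.
rewrite /cnt ler_wpM2r ?invr_ge0// ler_nat.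
have inj : {in [pred x | x \in ppreimage f B] &, injective (tot f)}.
  move=> x y; rewrite !inE => /ppreimageP[u _ fu] /ppreimageP[v _ fv].
  rewrite (tot_Some fu) (tot_Some fv) => uv; rewrite uv in fu.
  exact: pinjP fu fv.
rewrite -(card_in_imset inj); apply/subset_leq_card/fintype.subsetP => _ /imsetP[x + ->].
by rewrite !inE => /ppreimageP[u Bu fu]; rewrite (tot_Some fu).
Qed.

Lemma pinj_ext T (f g : pinj T) : f =1 g -> f = g.
Proof.
case: f g => [f fP] [g gP] /= /funext fg; move: fP gP; rewrite fg => fP gP.
by congr PInj.
Qed.

Section Transport.
Context (T : finType).
Implicit Types f g : pinj T.

Definition transport_fun f (m : 'I_#|T|) := omap enum_rank (f (enum_val m)).

Lemma transport_subproof f x x' y :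
  transport_fun f x = Some y -> transport_fun f x' = Some y -> x = x'.
Proof.
rewrite /transport_fun; case fx: (f _) => [z|//] [<-].
case fx': (f _) => [z'|//] [/enum_rank_inj zz']; rewrite zz' in fx'.
exact: enum_val_inj (pinjP fx fx').
Qed.

Definition transport f := PInj (@transport_subproof f).

Lemma transport_comp f g : transport (pinj_comp f g) =1 pinj_comp (transport f) (transport g).
Proof.
have trE h x : transport h x = omap enum_rank (h (enum_val x)) by [].
move=> m; rewrite [RHS]pcompE !trE pcompE.
by case: (g (enum_val m)) => [z|//]; rewrite [RHS]trE enum_rankK.
Qed.

Lemma transport_eq f g m : transport f m = transport g m <-> f (enum_val m) = g (enum_val m).
Proof.
rewrite /= /transport_fun; split=> [|->//].
by case: (f _) (g _) => [x|] [y|] //= [/enum_rank_inj ->].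
Qed.

End Transport.

(** Approximations of a product relation act naturally on a product of two finite
    types, which is only in bijection with an initial segment of the integers. *)
Lemma sofic_fin (F : realType) d (X : measurableType d) (mu : probability X F)
    (R : cber X) :
  (forall (K : set (fsg mu R)) (eps : F), finite_set K -> 0 < eps ->
   exists (T : finType) (pi : fsg mu R -> pinj T), (0 < #|T|)%N /\
    [/\ pi (fsg_of mu (borel_id R)) = pinj_id T,
        pi (fsg_of mu (borel_empty R)) = pinj_empty T,
        forall g h : borel_fsg R, K (fsg_of mu g) -> K (fsg_of mu h) ->
          cnt F [set m | pi (fsg_of mu (borel_comp g h)) m <>
                         pinj_comp (pi (fsg_of mu g)) (pi (fsg_of mu h)) m] < eps &
        forall g : borel_fsg R, K (fsg_of mu g) ->
          `| pr mu (pfix g) - cnt F (pfix (pi (fsg_of mu g))) | < eps]) ->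
  sofic mu R.
Proof.
move=> H K eps finK eps0.
have [T [pi [T0 [pi_id pi_empty pi_comp pi_fix]]]] := H K eps finK eps0.
exists #|T|, (fun a => transport (pi a)); split=> //; split.
- rewrite pi_id; apply: pinj_ext => m.
  by rewrite /= /transport_fun /= enum_valK.
- by rewrite pi_empty; exact: pinj_ext.
- move=> g h Kg Kh; rewrite d_countE; apply: le_lt_trans (pi_comp g h Kg Kh).
  rewrite -(cnt_bij F _ (@enum_val_bij T)); apply: le_cnt => m /=.
  rewrite -/(pinj_comp _ _ m) -/(transport_fun _ _) => ne eq.
  by apply: ne; rewrite -[RHS]transport_comp; apply/transport_eq.
- move=> g Kg; rewrite mu_countE (_ : pfix (transport _) = enum_val @^-1` pfix (pi (fsg_of mu g))).
    by rewrite cnt_bij; [exact: pi_fix|exact: enum_val_bij].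
  apply/seteqP; split=> m; rewrite /pfix /= /transport_fun.
    by case: (pi _ _) => [z|]//= [<-]; rewrite enum_rankK.
  by move=> ->; rewrite /= enum_valK.
Qed.

(** ** Properties of a point that depend on its local type *)

Section TypeFormulas.
Context (C J : finType) (cl : J -> C).
Notation L := (letter J).
Notation one := ((true, None) : L).
Notation none := ((false, None) : L).
Notation pos j := ((true, Some j) : L).
Notation neg j := ((false, Some j) : L).
Implicit Types (s t : {ffun L * L * L -> bool}) (c : C) (i j : J).

(** In a model, the letter [neg j] is not required to act everywhere as the
    inverse of the letter [pos j]; this holds at the points described here. *)
Definition regularb s := [forall j, s (one, pos j, none) || s (neg j, pos j, one)].

Definition definedb i s t := ~~ s (one, pos i, none) && ~~ t (one, pos i, none).

(** The last condition is what makes the models injective.  If a regular point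
    [p'] is moved to the same place as [p] by a piece [j] of the class [c], then
    [neg j] sends this place back to [p'], so that [p' = p] can be read off from
    the type of [p] alone. *)
Definition selectedb c i s t :=
  [&& regularb s, regularb t, cl i == c, definedb i s t,
      [forall j, (cl j == c) && definedb j s t ==>
         s (one, pos j, pos i) && t (one, pos j, pos i)] &
      [forall j, (cl j == c) ==> [|| s (neg j, pos i, none), t (neg j, pos i, none)
         | s (neg j, pos i, one) && t (neg j, pos i, one)]]].

Definition badb c s t := [|| ~~ regularb s, ~~ regularb t |
  [exists i, [&& cl i == c, definedb i s t & ~~ selectedb c i s t]]].

Definition mismatchb c c' c'' s t :=
  [exists i, exists j, [&& cl i == c, cl j == c', ~~ s (pos i, pos j, none),
     ~~ t (pos i, pos j, none) &
     [forall k, (cl k == c'') ==> ~~ (s (pos i, pos j, pos k) && t (pos i, pos j, pos k))]]]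
  || [exists k, [&& cl k == c'', definedb k s t &
     [forall i, forall j, (cl i == c) && (cl j == c') ==>
        ~~ (s (pos i, pos j, pos k) && t (pos i, pos j, pos k))]]].

Definition fixedb c s t :=
  [exists i, [&& cl i == c, s (one, pos i, one) & t (one, pos i, one)]].

Section Semantics.
Context (U V : Type) (rho : L -> U -> option U) (sigma : L -> V -> option V).
Hypothesis (rho1 : forall x, rho one x = Some x) (sigma1 : forall y, sigma one y = Some y).
Hypothesis (rho0 : forall x, rho none x = None) (sigma0 : forall y, sigma none y = None).
Implicit Types p q r : U * V.

Definition piece i p := prod_fun (rho (pos i)) (sigma (pos i)) p.
Definition back i p := prod_fun (rho (neg i)) (sigma (neg i)) p.
Definition regular p :=
  (forall j x, rho (pos j) p.1 = Some x -> rho (neg j) x = Some p.1) /\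
  (forall j y, sigma (pos j) p.2 = Some y -> sigma (neg j) y = Some p.2).
Definition selected c i p := [/\ regular p, cl i = c & exists q,
  [/\ piece i p = Some q, forall j q', cl j = c -> piece j p = Some q' -> q' = q &
      forall j p', cl j = c -> back j q = Some p' -> p' = p]].

Lemma pcomp_one (W : Type) (r : L -> W -> option W) l x :
  (forall x, r one x = Some x) -> pcomp (r one) (r l) x = r l x.
Proof. by move=> r1; rewrite /pcomp; case: (r l x) => //= z; rewrite r1. Qed.

Lemma regularbP p : regularb (ltype rho p.1) && regularb (ltype sigma p.2) <-> regular p.
Proof.
have reg1 (W : Type) (r : L -> W -> option W) w :
    (forall x, r one x = Some x) -> (forall x, r none x = None) ->
    regularb (ltype r w) <-> forall j x, r (pos j) w = Some x -> r (neg j) x = Some w.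
  move=> r1 r0; split.
    move=> /forallP reg j x jx; have /orP[] := reg j; move=> /ltypeP.
      by rewrite pcomp_one// r0 jx.
    by rewrite /pcomp jx /= r1.
  move=> reg; apply/forallP => j; case jx: (r (pos j) w) => [x|].
    by apply/orP; right; apply/ltypeP; rewrite /pcomp jx /= r1; exact: reg.
  by apply/orP; left; apply/ltypeP; rewrite pcomp_one// r0.
split; first by move=> /andP[/reg1 ? /reg1 ?]; split; auto.
by move=> [? ?]; apply/andP; split; apply/reg1.
Qed.

Lemma definedbP i p :
  definedb i (ltype rho p.1) (ltype sigma p.2) <-> exists q, piece i p = Some q.
Proof.
rewrite /definedb /piece /prod_fun; split.
  move=> /andP[/negP s0 /negP t0].
  case ix: (rho _ _) => [x|]; last by case: s0; apply/ltypeP; rewrite pcomp_one// rho0.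
  case iy: (sigma _ _) => [y|]; last by case: t0; apply/ltypeP; rewrite pcomp_one// sigma0.
  by exists (x, y).
move=> [q]; case ix: (rho _ _) => [x|//]; case iy: (sigma _ _) => [y|//] _.
apply/andP; split; apply/negP => /ltypeP; rewrite pcomp_one//.
  by rewrite ix rho0.
by rewrite iy sigma0.
Qed.

Lemma selectedbP c i p :
  selectedb c i (ltype rho p.1) (ltype sigma p.2) <-> selected c i p.
Proof.
split.
  case/and5P => r1 r2 /eqP ci /definedbP[q iq] /andP[/forallP eqs /forallP backs].
  split=> //; first by apply/regularbP; rewrite r1.
  have /prod_funP[iq1 iq2] := iq.
  exists q; split=> //.
    move=> j q' cj jq'; have /implyP := eqs j; rewrite cj eqxx /=.
    have dj : definedb j (ltype rho p.1) (ltype sigma p.2) by apply/definedbP; exists q'.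
    move=> /(_ dj)/andP[/ltypeP + /ltypeP]; rewrite !pcomp_one//.
    have /prod_funP[-> ->] := jq'; rewrite iq1 iq2 => -[q1] [q2].
    by rewrite [q]surjective_pairing -q1 -q2 -surjective_pairing.
  move=> j p' cj /prod_funP[b1 b2]; have /implyP := backs j.
  rewrite cj eqxx => /(_ isT)/or3P[/ltypeP|/ltypeP|/andP[/ltypeP + /ltypeP]].
  - by rewrite rho0 /pcomp iq1 /= b1.
  - by rewrite sigma0 /pcomp iq2 /= b2.
  - rewrite /pcomp iq1 iq2 /= b1 b2 rho1 sigma1 => -[p1] [p2].
    by rewrite [p']surjective_pairing p1 p2 -surjective_pairing.
move=> [/regularbP/andP[r1 r2] ci [q [iq eqs backs]]].
have /prod_funP[iq1 iq2] := iq.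
apply/and5P; split=> //; first exact/eqP.
  by apply/definedbP; exists q.
apply/andP; split; apply/forallP => j; apply/implyP.
  move=> /andP[/eqP cj /definedbP[q' jq']].
  have qq' := eqs _ _ cj jq'; have /prod_funP[jq1 jq2] := jq'.
  by apply/andP; split; apply/ltypeP; rewrite pcomp_one// ?jq1 ?jq2 ?iq1 ?iq2 qq'.
move=> /eqP cj; apply/or3P.
case b1: (rho (neg j) q.1) => [x|]; last first.
  by apply: Or31; apply/ltypeP; rewrite rho0 /pcomp iq1.
case b2: (sigma (neg j) q.2) => [y|]; last first.
  by apply: Or32; apply/ltypeP; rewrite sigma0 /pcomp iq2.
have pE : (x, y) = p by apply: (backs j) => //; apply/prod_funP.
apply: Or33; apply/andP; split; apply/ltypeP.
  by rewrite /pcomp iq1 /= b1 rho1 -pE.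
by rewrite /pcomp iq2 /= b2 sigma1 -pE.
Qed.

Lemma badbPn c p : ~~ badb c (ltype rho p.1) (ltype sigma p.2) <->
  regular p /\ forall i q, cl i = c -> piece i p = Some q -> selected c i p.
Proof.
rewrite /badb !negb_or !(negbK (regularb _)); split.
  move=> /and3P[r1 r2 /existsPn nsel]; split; first by apply/regularbP; rewrite r1.
  move=> i q ci iq; apply/selectedbP; apply: contrapT => /negP ns.
  have /negP := nsel i; apply; rewrite ns ci eqxx andbT /=.
  by apply/definedbP; exists q.
move=> [/regularbP/andP[r1 r2] sel]; rewrite r1 r2 /=.
apply/existsPn => i; apply/negP => /and3P[/eqP ci /definedbP[q iq] /negP]; apply.
exact/selectedbP/(sel _ q).
Qed.

Lemma mismatchbPn c c' c'' p : ~~ mismatchb c c' c'' (ltype rho p.1) (ltype sigma p.2) <->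
  forall q, (exists i j r, [/\ cl i = c, cl j = c', piece j p = Some r & piece i r = Some q])
        <-> (exists2 k, cl k = c'' & piece k p = Some q).
Proof.
have compP i j q : (exists2 r, piece j p = Some r & piece i r = Some q) <->
    pcomp (rho (pos i)) (rho (pos j)) p.1 = Some q.1 /\
    pcomp (sigma (pos i)) (sigma (pos j)) p.2 = Some q.2.
  rewrite /pcomp; split.
    by move=> [r /prod_funP[-> ->] /prod_funP[]].
  case jx: (rho _ p.1) => [x|]; last by case.
  case jy: (sigma _ p.2) => [y|]; last by case.
  by move=> [ix iy]; exists (x, y); apply/prod_funP.
have agree i j k q : piece k p = Some q ->
    (ltype rho p.1 (pos i, pos j, pos k) && ltype sigma p.2 (pos i, pos j, pos k)) <->
    exists2 r, piece j p = Some r & piece i r = Some q.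
  move=> /prod_funP[k1 k2]; rewrite compP; split.
    by move=> /andP[/ltypeP -> /ltypeP ->].
  by move=> [e1 e2]; apply/andP; split; apply/ltypeP; rewrite ?e1 ?e2.
rewrite /mismatchb negb_or; split.
  move=> /andP[/existsPn mis1 /existsPn mis2] q; split.
    move=> [i [j [r [ci cj jr iq]]]].
    have /existsPn mis1i := mis1 i; have := mis1i j; rewrite ci cj !eqxx /=.
    have [c1 c2] := (compP i j q).1 (ex_intro2 _ _ r jr iq).
    have -> : ~~ ltype rho p.1 (pos i, pos j, none).
      by apply/negP => /ltypeP; rewrite c1 rho0.
    have -> : ~~ ltype sigma p.2 (pos i, pos j, none).
      by apply/negP => /ltypeP; rewrite c2 sigma0.
    move=> /forallPn[k]; rewrite negb_imply negbK => /andP[/eqP ck].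
    move=> /andP[/ltypeP k1 /ltypeP k2]; exists k => //.
    by apply/prod_funP; rewrite -k1 -k2.
  move=> [k ck kq]; have := mis2 k; rewrite ck eqxx /=.
  have -> : definedb k (ltype rho p.1) (ltype sigma p.2) by apply/definedbP; exists q.
  move=> /forallPn[i]; move=> /forallPn[j]; rewrite negb_imply negbK => /andP[/andP[/eqP ci /eqP cj]].
  by move=> /(agree i j k q kq)[r jr iq]; exists i, j, r.
move=> same; apply/andP; split; apply/existsPn.
  move=> i; apply/existsPn => j; apply/negP => /and5P[/eqP ci /eqP cj /negP n1 /negP n2].
  move=> /forallP none_k.
  case c1: (pcomp (rho (pos i)) (rho (pos j)) p.1) => [x|]; last first.
    by apply: n1; apply/ltypeP; rewrite c1 rho0.
  case c2: (pcomp (sigma (pos i)) (sigma (pos j)) p.2) => [y|]; last first.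
    by apply: n2; apply/ltypeP; rewrite c2 sigma0.
  have [r jr iq] := (compP i j (x, y)).2 (conj c1 c2).
  have [k ck kq] := (same (x, y)).1 (ex_intro _ i (ex_intro _ j (ex_intro _ r
    (And4 ci cj jr iq)))).
  have /implyP := none_k k; rewrite ck eqxx => /(_ isT)/negP; apply.
  by apply/(agree i j k (x, y) kq); exists r.
move=> k; apply/negP => /and3P[/eqP ck /definedbP[q kq] /forallP none_ij].
have [i [j [r [ci cj jr iq]]]] := (same q).2 (ex_intro2 _ _ k ck kq).
have /forallP none_i := none_ij i; have /implyP := none_i j; rewrite ci cj !eqxx => /(_ isT)/negP; apply.
by apply/(agree i j k q kq); exists r.
Qed.

Lemma fixedbP c p : fixedb c (ltype rho p.1) (ltype sigma p.2) <->
  exists2 i, cl i = c & piece i p = Some p.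
Proof.
split.
  move=> /existsP[i /and3P[/eqP ci /ltypeP + /ltypeP]]; rewrite !pcomp_one// rho1 sigma1.
  by move=> i1 i2; exists i => //; apply/prod_funP.
move=> [i ci /prod_funP[i1 i2]]; apply/existsP; exists i; rewrite ci eqxx /=.
by apply/andP; split; apply/ltypeP; rewrite pcomp_one// ?rho1 ?sigma1.
Qed.

End Semantics.
End TypeFormulas.

(** ** The approximation built from pieces *)

Section ProductModel.
Context (F : realType) d1 d2 (X : measurableType d1) (Y : measurableType d2).
Context (mu : probability X F) (nu : probability Y F) (R : cber X) (S : cber Y).
Hypothesis (mX : diag_measurable X) (mY : diag_measurable Y).
Hypothesis (hR : measure_preserving mu R) (hS : measure_preserving nu S).
Let lam := (mu \x nu)%E.
Let mXY : diag_measurable (X * Y)%type := diag_measurable_prod mX mY.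

Context (C J : finType) (cl : J -> C).
Variables (phi : C -> borel_fsg (cber_prod R S)) (G : C -> set (X * Y)).
Variables (g : J -> borel_fsg R) (h : J -> borel_fsg S) (delta : F).
Hypothesis mG : forall c, measurable (G c).
Hypothesis G_lt : forall c, pr lam (~` G c) < delta.
Hypothesis piece_phi : forall j z q, G (cl j) z ->
  borel_prod (g j) (h j) z = Some q -> phi (cl j) z = Some q.
Hypothesis phi_piece : forall c z, G c z -> pdom (phi c) z ->
  exists2 j, cl j = c & exists q, borel_prod (g j) (h j) z = Some q.
Hypothesis piece_inj : forall j z p q, G (cl j) z -> phi (cl j) z = Some q ->
  borel_prod (g j) (h j) p = Some q -> p = z.

Context (M N : nat) (rho : letter J -> pinj 'I_M) (sigma : letter J -> pinj 'I_N).
Hypothesis (rho_one : rho (true, None) = pinj_id 'I_M).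
Hypothesis (sigma_one : sigma (true, None) = pinj_id 'I_N).
Hypothesis (rho_none : rho (false, None) = pinj_empty 'I_M).
Hypothesis (sigma_none : sigma (false, None) = pinj_empty 'I_N).
Notation types := {ffun letter J * letter J * letter J -> bool}.
Hypothesis statistics : forall Q : types -> types -> bool,
  cnt F [set p | Q (ltype rho p.1) (ltype sigma p.2)] <=
  pr lam [set z | Q (ltype (spell g) z.1) (ltype (spell h) z.2)] + delta.

Hypothesis MN0 : (0 < #|{: 'I_M * 'I_N}|)%N.

Let pphi c j z q : cl j = c -> G c z -> borel_prod (g j) (h j) z = Some q ->
  phi c z = Some q.
Proof. by move=> <-; exact: piece_phi. Qed.

Let rho1 x : rho (true, None) x = Some x. Proof. by rewrite rho_one. Qed.
Let sigma1 y : sigma (true, None) y = Some y. Proof. by rewrite sigma_one. Qed.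
Let rho0 x : rho (false, None) x = None. Proof. by rewrite rho_none. Qed.
Let sigma0 y : sigma (false, None) y = None. Proof. by rewrite sigma_none. Qed.

Let spell1 d (Z : measurableType d) (Q : cber Z) (f : J -> borel_fsg Q) x :
  spell f (true, None) x = Some x.
Proof. by []. Qed.
Let spell0 d (Z : measurableType d) (Q : cber Z) (f : J -> borel_fsg Q) x :
  spell f (false, None) x = None.
Proof. by []. Qed.

Let frho l : 'I_M -> option 'I_M := rho l.
Let fsigma l : 'I_N -> option 'I_N := sigma l.
Let fg l : X -> option X := spell g l.
Let fh l : Y -> option Y := spell h l.
Let msel := @selectedbP _ _ cl _ _ frho fsigma rho1 sigma1 rho0 sigma0.
Let mbad := @badbPn _ _ cl _ _ frho fsigma rho1 sigma1 rho0 sigma0.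
Let mmis := @mismatchbPn _ _ cl _ _ frho fsigma rho1 sigma1 rho0 sigma0.
Let mfixed := @fixedbP _ _ cl _ _ frho fsigma rho1 sigma1.
Let xbad := @badbPn _ _ cl _ _ fg fh (spell1 g) (spell1 h) (spell0 g) (spell0 h).
Let xmis := @mismatchbPn _ _ cl _ _ fg fh (spell1 g) (spell1 h) (spell0 g) (spell0 h).
Let xfixed := @fixedbP _ _ cl _ _ fg fh (spell1 g) (spell1 h).

Let mtype (Q : types -> types -> bool) : measurable [set z : X * Y | Q (ltype (spell g) z.1) (ltype (spell h) z.2)].
Proof.
apply: (@measurable_fibers _ _ _ (fun z : X * Y => (ltype (spell g) z.1, ltype (spell h) z.2))
  (fun st => Q st.1 st.2)) => -[s t].
rewrite (_ : mkset _ = [set x | ltype (spell g) x = s] `*` [set y | ltype (spell h) y = t]).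
  by apply: measurableX; exact: measurable_ltype.
by apply/seteqP; split=> z /= => [[-> ->]|[<- <-]].
Qed.

(** The points without a selected piece are left out to make the map injective.
    The choice made by [pick] is immaterial because all the pieces of the class
    [c] defined at a point agree there as soon as one of them is selected. *)
Definition model_fun c (p : 'I_M * 'I_N) : option ('I_M * 'I_N) :=
  if [pick i | selectedb cl c i (ltype rho p.1) (ltype sigma p.2)] is Some i
  then piece rho sigma i p else None.

Lemma model_fun_selected c p q : model_fun c p = Some q ->
  exists2 i, selected cl rho sigma c i p & piece rho sigma i p = Some q.
Proof. by rewrite /model_fun; case: pickP => [i /msel si iq|//]; exists i. Qed.

Lemma model_subproof c p p' q :
  model_fun c p = Some q -> model_fun c p' = Some q -> p = p'.
Proof.
move=> /model_fun_selected[i [_ _ [q1 [iq1 _ backs]]] iq].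
move=> /model_fun_selected[j [[reg1 reg2] cj _] /prod_funP[j1 j2]].
move: iq; rewrite iq1 => -[qq]; apply/esym/(backs j) => //.
by apply/prod_funP; rewrite qq; split; [exact: reg1|exact: reg2].
Qed.

Definition model c := PInj (@model_subproof c).

Lemma modelP c p q : ~~ badb cl c (ltype rho p.1) (ltype sigma p.2) ->
  (model c p = Some q <-> exists2 i, cl i = c & piece rho sigma i p = Some q).
Proof.
move=> /mbad[reg sel]; split.
  by move=> /model_fun_selected[i [_ ci _] iq]; exists i.
move=> [i ci iq]; rewrite /= /model_fun; case: pickP => [j /msel[_ cj [q' [jq' eqs _]]]|none].
  by rewrite jq' (eqs _ _ ci iq).
by have /msel := sel i q ci iq; rewrite [selectedb _ _ _ _ _]none.
Qed.

Lemma pieceE i z : piece (spell g) (spell h) i z = borel_prod (g i) (h i) z.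
Proof. by []. Qed.

Lemma good_not_bad c z : G c z ->
  ~~ badb cl c (ltype (spell g) z.1) (ltype (spell h) z.2).
Proof.
move=> Gz; have reg : regular (spell g) (spell h) z by split=> j x /borel_invP.
apply/xbad; split=> // i q ci iq; split=> //; exists q; split=> //.
  move=> j q' cj jq'.
  have pq : phi c z = Some q by exact: (pphi ci).
  have : phi c z = Some q' by exact: (pphi cj).
  by rewrite pq => -[].
move=> j p' cj /prod_funP[/borel_invP b1 /borel_invP b2].
apply: (piece_inj (j := j) (q := q)); rewrite ?cj//.
  exact: (pphi ci).
exact/prod_funP.
Qed.

Lemma pr_bad c :
  pr lam [set z | badb cl c (ltype (spell g) z.1) (ltype (spell h) z.2)] <= delta.
Proof.
apply: le_trans (ltW (G_lt c)); apply: le_pr; [exact: mtype|exact: measurableC|].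
by move=> z /= bz Gz; have := good_not_bad Gz; rewrite bz.
Qed.

Lemma cnt_bad c :
  cnt F [set p | badb cl c (ltype rho p.1) (ltype sigma p.2)] <= 2 * delta.
Proof. by apply: le_trans (statistics (badb cl c)) _; have := pr_bad c; lra. Qed.

Section Composition.
Variables (c c' c'' : C).
Hypothesis phi_comp :
  pr lam [set z | phi c'' z <> borel_comp (phi c) (phi c') z] = 0.

(** On [G c'] and [G c''], and when [phi c'] leads to [G c], the pieces of each of
    the three maps determine that map. *)
Lemma pr_mismatch : pr lam [set z |
  mismatchb cl c c' c'' (ltype (spell g) z.1) (ltype (spell h) z.2)] <= 3 * delta.
Proof.
pose B1 := ~` G c'; pose B2 := ~` G c''.
pose B3 := ppreimage (phi c') (~` G c).
pose B4 := [set z | phi c'' z <> borel_comp (phi c) (phi c') z].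
have mB1 : measurable B1 by exact: measurableC.
have mB2 : measurable B2 by exact: measurableC.
have mB3 : measurable B3 by apply: fsg_preimage; exact: measurableC.
have mB4 : measurable B4 by exact: measurable_neq.
have B3_lt : pr lam B3 < delta.
  apply: le_lt_trans (G_lt c).
  by apply: (pr_preimage_le mX mY hR hS); exact: measurableC.
have sub : [set z | mismatchb cl c c' c'' (ltype (spell g) z.1) (ltype (spell h) z.2)]
    `<=` (B1 `|` B2) `|` (B3 `|` B4).
  move=> z /= mis; apply: contrapT => nB.
  have G1 : G c' z by apply: contrapT => ?; apply: nB; left; left.
  have G2 : G c'' z by apply: contrapT => ?; apply: nB; left; right.
  have G3 r : phi c' z = Some r -> G c r.
    move=> zr; apply: contrapT => nG; apply: nB; right; left.
    by apply/ppreimageP; exists r.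
  have e4 : phi c'' z = borel_comp (phi c) (phi c') z.
    by apply: contrapT => ?; apply: nB; right; right.
  rewrite [RHS]pcompE in e4.
  suff /xmis : forall q, (exists i j r, [/\ cl i = c, cl j = c',
      piece (spell g) (spell h) j z = Some r & piece (spell g) (spell h) i r = Some q]) <->
      (exists2 k, cl k = c'' & piece (spell g) (spell h) k z = Some q).
    by move=> /negP; apply.
  move=> q; split.
    move=> [i [j [r [ci cj jr iq]]]].
    have zr : phi c' z = Some r by exact: (pphi cj).
    have rq : phi c r = Some q by apply: (pphi ci) => //; exact: G3.
    have zq : phi c'' z = Some q by rewrite e4 zr.
    have [|k ck [q' kq']] := phi_piece G2; first by apply/pdomP; exists q.
    have : phi c'' z = Some q' by exact: (pphi ck).
    by rewrite zq => -[->]; exists k.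
  move=> [k ck kq].
  have : phi c'' z = Some q by exact: (pphi ck).
  rewrite e4; case zr: (phi c' z) => [r|//] rq.
  have [|j cj [r' jr']] := phi_piece G1; first by apply/pdomP; exists r.
  have r'r : r' = r.
    have : phi c' z = Some r' by exact: (pphi cj).
    by rewrite zr => -[].
  have [|i ci [q' iq']] := phi_piece (G3 _ zr); first by apply/pdomP; exists q.
  have q'q : q' = q.
    have : phi c r = Some q'.
      by apply: (pphi ci) => //; exact: G3.
    by rewrite rq => -[].
  by rewrite r'r in jr'; rewrite q'q in iq'; exists i, j, r.
have := pr_subU lam (mtype (mismatchb cl c c' c'')) (measurableU _ _ mB1 mB2)
  (measurableU _ _ mB3 mB4) sub.
have := pr_setU_le lam mB1 mB2; have := pr_setU_le lam mB3 mB4.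
have := G_lt c'; have := G_lt c''.
move: B3_lt; rewrite phi_comp /B1 /B2; lra.
Qed.

(** Where the type is good for [c''] and [c'], and the model of [c'] leads to a
    point whose type is good for [c], the models are the unions of their pieces.
    The points excluded by the last condition are no more numerous than the bad
    points for [c], because the model of [c'] is injective. *)
Lemma model_comp : cnt F [set p | model c'' p <> pinj_comp (model c) (model c') p] <=
  10 * delta.
Proof.
pose bad c p := badb cl c (ltype rho p.1) (ltype sigma p.2).
pose mis p := mismatchb cl c c' c'' (ltype rho p.1) (ltype sigma p.2).
have sub : [set p | model c'' p <> pinj_comp (model c) (model c') p] `<=`
    ([set p | bad c'' p] `|` [set p | bad c' p]) `|`
    (ppreimage (model c') [set p | bad c p] `|` [set p | mis p]).
  move=> p /= ne; apply: contrapT => nB; apply: ne.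
  have b1 : ~~ bad c'' p by apply/negP => ?; apply: nB; left; left.
  have b2 : ~~ bad c' p by apply/negP => ?; apply: nB; left; right.
  have b3 r : model c' p = Some r -> ~~ bad c r.
    move=> pr'; apply/negP => br; apply: nB; right; left.
    by apply/ppreimageP; exists r.
  have b4 : ~~ mis p by apply/negP => ?; apply: nB; right; right.
  have {}b4 := (mmis c c' c'' p).1 b4.
  apply: option_ext => q; rewrite (modelP _ b1) -b4 -[pcomp _ _ _]/(pinj_comp (model c) (model c') p) pcompE; split.
    move=> [i [j [r [ci cj jr iq]]]].
    have prr : model c' p = Some r by apply/(modelP _ b2); exists j.
    by rewrite prr; apply/(modelP _ (b3 _ prr)); exists i.
  case prr: (model c' p) => [r|//] /(modelP _ (b3 _ prr))[i ci iq].
  by have /(modelP _ b2)[j cj jr] := prr; exists i, j, r.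
have := cnt_subU F sub.
have := cnt_setU_le F [set p | bad c'' p] [set p | bad c' p].
have := cnt_setU_le F (ppreimage (model c') [set p | bad c p]) [set p | mis p].
have := cnt_ppreimage_le F (model c') [set p | bad c p].
have := cnt_bad c; have := cnt_bad c'; have := cnt_bad c''.
have := statistics (mismatchb cl c c' c''); have := pr_mismatch.
rewrite /bad /mis; lra.
Qed.

End Composition.

Lemma model_fix c : `|pr lam (pfix (phi c)) - cnt F (pfix (model c))| <= 4 * delta.
Proof.
pose fx z := fixedb cl c (ltype (spell g) z.1) (ltype (spell h) z.2).
pose fxm p := fixedb cl c (ltype rho p.1) (ltype sigma p.2).
have mfix : measurable (pfix (phi c)) by exact: measurable_pfix.
have mfx : measurable [set z | fx z] by exact: mtype.
have mC : measurable (~` G c) by exact: measurableC.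
have e1 : pr lam [set z | fx z] <= pr lam (pfix (phi c)) + pr lam (~` G c).
  apply: pr_subU => // z; have [Gz|nG] := pselect (G c z); last by right.
  move=> /xfixed[i ci iz]; left; exact: (pphi ci Gz iz).
have e2 : pr lam (pfix (phi c)) <= pr lam [set z | fx z] + pr lam (~` G c).
  apply: pr_subU => // z; have [Gz|nG] := pselect (G c z); last by right.
  move=> fz; left; apply/xfixed.
  have [|j cj [q jq]] := phi_piece Gz; first by apply/pdomP; exists z.
  exists j => //; rewrite pieceE jq; have : phi c z = Some q.
    exact: (pphi cj).
  by rewrite (fz : phi c z = Some z) => -[->].
have e3 : cnt F (pfix (model c)) <= cnt F [set p | fxm p].
  apply: le_cnt => p /model_fun_selected[i [_ ci _] ip].
  by apply/mfixed; exists i.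
have e4 : cnt F [set p | fxm p] <= cnt F (pfix (model c)) +
    cnt F [set p | badb cl c (ltype rho p.1) (ltype sigma p.2)].
  apply: cnt_subU => p /mfixed[i ci ip].
  have [bp|nbp] := boolP (badb cl c (ltype rho p.1) (ltype sigma p.2)); first by right.
  by left; apply/(modelP _ nbp); exists i.
have e5 := statistics (fixedb cl c).
have e6 := statistics (fun s t => ~~ fixedb cl c s t).
have mn1 : cnt F [set p | fxm p] + cnt F [set p | ~~ fxm p] = 1.
  rewrite -cnt_disjU; last by apply/seteqP; split=> p //= [->].
  rewrite -(cnt_setT F MN0).
  by congr (cnt F _); apply/seteqP; split=> p //= _; case: (fxm p); [left|right].
have e7 : pr lam [set z | ~~ fx z] = 1 - pr lam [set z | fx z].
  by rewrite -pr_setC//; congr (pr lam _); apply/seteqP; split=> z /= /negP.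
have e8 := cnt_bad c; have e9 := G_lt c.
rewrite ler_norml; apply/andP; split;
  move: e1 e2 e3 e4 e5 e6 mn1 e7 e8 e9; rewrite /fx /fxm; lra.
Qed.

(** A partial injection with many fixed points is close to the identity. *)
Lemma model_id c : pr lam [set z | phi c z <> Some z] = 0 ->
  cnt F [set p | model c p <> Some p] <= 4 * delta.
Proof.
move=> ae; have mfix : measurable (pfix (phi c)) by exact: measurable_pfix.
have := pr_setC lam mfix.
have -> : ~` pfix (phi c) = [set z | phi c z <> Some z] by [].
rewrite ae => fix1.
have : cnt F (pfix (model c)) + cnt F [set p | model c p <> Some p] = 1.
  rewrite -cnt_disjU; last by apply/seteqP; split=> p // -[fp] /(_ fp).
  rewrite -(cnt_setT F MN0); congr (cnt F _); apply/seteqP; split=> p //= _.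
  by have [fp|nfp] := pselect (model c p = Some p); [left|right].
have := model_fix c; rewrite ler_norml => /andP[_]; lra.
Qed.

(** An approximate idempotent fixes most points of its domain, so it is close to
    the empty map when it has few fixed points. *)
Lemma model_empty c : pr lam (pdom (phi c)) = 0 ->
  cnt F (pdom (model c)) <= 14 * delta.
Proof.
move=> ae; have mfix : measurable (pfix (phi c)) by exact: measurable_pfix.
have mdom := measurable_pdom (phi c).
have fix0 : pr lam (pfix (phi c)) = 0.
  apply/eqP; rewrite eq_le pr_ge0 andbT -ae; apply: le_pr => // z fz.
  by apply/pdomP; exists z.
have comp0 : pr lam [set z | phi c z <> borel_comp (phi c) (phi c) z] = 0.
  apply/eqP; rewrite eq_le pr_ge0 andbT -ae; apply: le_pr => //.
    exact: measurable_neq.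
  move=> z /= ne; apply: contrapT => /pdomPn zN; apply: ne.
  by rewrite [RHS]pcompE zN.
have sub : pdom (model c) `<=` pfix (model c) `|`
    [set p | model c p <> pinj_comp (model c) (model c) p].
  move=> p /pdomP[q pq].
  have [e|ne] := pselect (model c p = pinj_comp (model c) (model c) p); last by right.
  left; move: e; rewrite pcompE pq => /esym qq.
  by move: (pq); rewrite (pinjP qq pq).
have := cnt_subU F sub; have := model_comp comp0.
have := model_fix c; rewrite fix0 sub0r normrN ger0_norm ?cnt_ge0//; lra.
Qed.

End ProductModel.

(** * Soficity of the product *)

Section ProductClasses.
Context (F : realType) d1 d2 (X : measurableType d1) (Y : measurableType d2).
Context (mu : probability X F) (nu : probability Y F) (R : cber X) (S : cber Y).
Hypothesis (mX : diag_measurable X) (mY : diag_measurable Y).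
Hypothesis (hR : measure_preserving mu R) (hS : measure_preserving nu S).
Let lam := (mu \x nu)%E.
Let mXY : diag_measurable (X * Y)%type := diag_measurable_prod mX mY.
Implicit Types g h : borel_fsg (cber_prod R S).

Lemma fsg_of_comp g g' h h' : fsg_of lam g = fsg_of lam g' ->
  fsg_of lam h = fsg_of lam h' ->
  fsg_of lam (borel_comp g h) = fsg_of lam (borel_comp g' h').
Proof.
move=> /(fsg_of_eqP _ mXY) gg' /(fsg_of_eqP _ mXY) hh'; apply/(fsg_of_eqP _ mXY).
have mg := measurable_neq g g' mXY; have mh := measurable_neq h h' mXY.
have mpre := fsg_preimage h mg.
have pre0 : pr lam (ppreimage h [set z | g z <> g' z]) = 0.
  apply/eqP; rewrite eq_le pr_ge0 andbT -gg'.
  exact: (pr_preimage_le mX mY hR hS).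
have sub : [set z | borel_comp g h z <> borel_comp g' h' z] `<=`
    [set z | h z <> h' z] `|` ppreimage h [set z | g z <> g' z].
  move=> z ne; have [hz|] := pselect (h z = h' z); last by left.
  right; move: ne; rewrite /mkset [borel_comp g h z]pcompE [borel_comp g' h' z]pcompE -hz.
  by case hzr: (h z) => [r|//] gr; apply/ppreimageP; exists r.
apply/eqP; rewrite eq_le pr_ge0 andbT.
have := pr_subU lam (measurable_neq (borel_comp g h) (borel_comp g' h') mXY) mh mpre sub.
by rewrite hh' pre0 addr0.
Qed.

Lemma fsg_of_fix g g' : fsg_of lam g = fsg_of lam g' ->
  pr lam (pfix g) = pr lam (pfix g').
Proof.
have le k k' : fsg_of lam k = fsg_of lam k' -> pr lam (pfix k) <= pr lam (pfix k').
  move=> /(fsg_of_eqP _ mXY) kk'; rewrite -[leRHS]addr0 -kk'.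
  apply: pr_subU; [exact: measurable_pfix|exact: measurable_pfix|exact: measurable_neq|].
  move=> z kz; have [e|ne] := pselect (k z = k' z); [left|by right].
  by rewrite /pfix /= -e.
by move=> gg'; apply/eqP; rewrite eq_le !le.
Qed.

Lemma fsg_of_id_empty : fsg_of lam (borel_id (cber_prod R S)) <>
  fsg_of lam (borel_empty (cber_prod R S)).
Proof.
move=> /(fsg_of_eqP _ mXY); rewrite (_ : mkset _ = setT).
  by rewrite pr_setT => /eqP; rewrite oner_eq0.
by apply/seteqP; split=> z.
Qed.

(** The definition of soficity prescribes the images of the identity and of the
    empty map exactly, while the models are only close to them; so the models of
    these two classes are replaced.  A class may be named by several indices,
    with different pieces, and one of them is chosen for each class. *)
Lemma sofic_prod : matches_local_types mu R -> matches_local_types nu S ->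
  sofic lam (cber_prod R S).
Proof.
move=> matR matS; apply: sofic_fin => K eps finK eps0.
(* replacing the models of the identity and the empty map by these maps costs at
   most [14 * delta] for each of the three maps of a product, whose models are
   compatible up to [10 * delta] *)
pose delta := eps / 100; have delta0 : 0 < delta by rewrite divr_gt0.
have [n [a Ka]] := finite_enum finK.
have [rep repE] := choice (@fsg_ofK _ _ _ lam (cber_prod R S)).
pose C : finType := ('I_n + 'I_n * 'I_n)%type.
pose phi (c : C) := match c with
  | inl i => rep (a i) | inr ij => borel_comp (rep (a ij.1)) (rep (a ij.2)) end.
have /choice[w wP] : forall c, exists w : set (X * Y) *
    {I : finType & ((I -> borel_fsg R) * (I -> borel_fsg S))%type},
    [/\ measurable w.1, pr lam (~` w.1) < delta &
        pieces_of (phi c) (pdom (phi c)) w.1 (projT2 w.2).1 (projT2 w.2).2].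
  move=> c; have [G [I [g [h [mG Glt P]]]]] := exists_pieces mX mY hR hS (phi c) delta0.
  by exists (G, existT _ I (g, h)).
pose G c := (w c).1.
pose J : finType := {c : C & projT1 (w c).2}.
pose cl (j : J) : C := tag j.
pose g (j : J) : borel_fsg R := (projT2 (w (tag j)).2).1 (tagged j).
pose h (j : J) : borel_fsg S := (projT2 (w (tag j)).2).2 (tagged j).
pose types := {ffun letter J * letter J * letter J -> bool}.
pose k : F := #|{: types * types}|%:R.
have k0 : 0 <= k by rewrite /k.
pose e := delta / (2 * k + 1).
have e0 : 0 < e by rewrite divr_gt0// ltr_wpDl// mulr_ge0.
have eE : e * (2 * k + 1) = delta.
  by rewrite /e divfK// lt0r_neq0// ltr_wpDl// mulr_ge0.
have [M [rho [M0 rho1 rho0 rhoP]]] := matR J g e e0.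
have [N [sigma [N0 sigma1 sigma0 sigmaP]]] := matS J h e e0.
have stat (Q : types -> types -> bool) :
    cnt F [set p | Q (ltype rho p.1) (ltype sigma p.2)] <=
    pr lam [set z | Q (ltype (spell g) z.1) (ltype (spell h) z.2)] + delta.
  have M0' : (0 < #|'I_M|)%N by rewrite card_ord.
  have N0' : (0 < #|'I_N|)%N by rewrite card_ord.
  apply: le_trans (joint_statistics M0' N0' (ltW e0) (measurable_ltype mX g)
    (measurable_ltype mY h) rhoP sigmaP Q) _.
  by rewrite lerD2l -eE mulrDr mulr1 mulrA [e * 2]mulrC lerDl ltW.
have MN0 : (0 < #|{: 'I_M * 'I_N}|)%N by rewrite card_prod !card_ord muln_gt0 M0.
have mG c : measurable (G c) by case: (wP c).
have Glt c : pr lam (~` G c) < delta by case: (wP c).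
have P1 j z q : G (cl j) z -> borel_prod (g j) (h j) z = Some q -> phi (cl j) z = Some q.
  by have [_ _ [+ _ _]] := wP (cl j); apply.
have P2 c z : G c z -> pdom (phi c) z ->
    exists2 j, cl j = c & exists q, borel_prod (g j) (h j) z = Some q.
  have [_ _ [_ + _]] := wP c => P Gz dz; have [i [q iq]] := P z Gz dz.
  by exists (Tagged (fun c => projT1 (w c).2) i) => //; exists q.
have P3 j z p q : G (cl j) z -> phi (cl j) z = Some q ->
    borel_prod (g j) (h j) p = Some q -> p = z.
  by have [_ _ [_ _ +]] := wP (cl j); apply.
pose mod c := model cl rho1 sigma1 rho0 sigma0 c.
have mod_comp c c' c'' : fsg_of lam (phi c'') = fsg_of lam (borel_comp (phi c) (phi c')) ->
    cnt F [set p | mod c'' p <> pinj_comp (mod c) (mod c') p] <= 10 * delta.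
  by move=> /(fsg_of_eqP _ mXY); exact: (model_comp mX mY hR hS mG Glt P1 P2 P3).
have mod_fix c : `|pr lam (pfix (phi c)) - cnt F (pfix (mod c))| <= 4 * delta.
  exact: (model_fix mX mY mG Glt P1 P2 P3).
pose one := fsg_of lam (borel_id (cber_prod R S)).
pose zero := fsg_of lam (borel_empty (cber_prod R S)).
pose pi (kappa : fsg lam (cber_prod R S)) : pinj ('I_M * 'I_N)%type :=
  if pselect (kappa = one) then pinj_id _ else
  if pselect (kappa = zero) then pinj_empty _ else
  if pselect (exists c, fsg_of lam (phi c) = kappa) is left ex then mod (projT1 (cid ex))
  else pinj_empty _.
have piP kappa : (exists c, fsg_of lam (phi c) = kappa) ->
    exists2 c, fsg_of lam (phi c) = kappa & cnt F [set p | pi kappa p <> mod c p] <= 14 * delta.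
  move=> ex; rewrite /pi; case: pselect => [k1|nk1] /=.
    have [c ck] := ex; exists c => //.
    rewrite (_ : mkset _ = [set p | mod c p <> Some p]).
      have /(model_id mX mY mG Glt P1 P2 P3 rho1 sigma1 rho0 sigma0 stat MN0) : pr lam [set z | phi c z <> Some z] = 0.
        by apply/(fsg_of_eqP _ mXY _ (borel_id _)); rewrite ck.
      by rewrite -/(mod c); lra.
    by apply/seteqP; split=> p /= + /esym.
  case: pselect => [k1|nk2] /=.
    have [c ck] := ex; exists c => //.
    rewrite (_ : mkset _ = pdom (mod c)).
      have : pr lam (pdom (phi c)) = 0.
        have /(fsg_of_eqP _ mXY) : fsg_of lam (phi c) = zero by rewrite ck.
        move=> z0; rewrite -[RHS]z0; congr (pr lam _).
        by apply/seteqP; split=> z /=; rewrite /pdom /=; case: (phi c z).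
      exact: (model_empty mX mY hR hS mG Glt P1 P2 P3).
    apply/seteqP; split=> p.
      by move=> ne; apply: contrapT => /pdomPn pN; apply: ne; rewrite [RHS]pN.
    by move=> /pdomP[q pq] ne; have := etrans ne pq.
  case: pselect => // ex'; case: cid => c ck /=; exists c => //.
  rewrite (_ : mkset _ = set0); first by rewrite cnt_set0 mulr_ge0// ltW.
  by apply/seteqP; split.
have K_phi x : K (fsg_of lam x) -> exists i, fsg_of lam (phi (inl i)) = fsg_of lam x.
  by move=> /Ka[i _ ai]; exists i; rewrite -ai -repE.
have deltaE : eps = 100 * delta by rewrite /delta mulrC divfK.
exists ('I_M * 'I_N)%type, pi; split=> //; split.
- by rewrite /pi; case: pselect.
- rewrite /pi; case: pselect => [/esym/fsg_of_id_empty//|_] /=.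
  by case: pselect.
- move=> x y Kx Ky; have [i ix] := K_phi x Kx; have [j jy] := K_phi y Ky.
  have ijE : fsg_of lam (phi (inr (i, j))) = fsg_of lam (borel_comp x y).
    exact: fsg_of_comp ix jy.
  have [c1 c1E d1_le] := piP _ (ex_intro _ _ ix).
  have [c2 c2E d2_le] := piP _ (ex_intro _ _ jy).
  have [c3 c3E d3_le] := piP _ (ex_intro _ _ ijE).
  have := mod_comp c1 c2 c3; rewrite c3E => /(_ (esym (fsg_of_comp c1E c2E))) d4_le.
  set D1 := [set p | _] in d1_le; set D2 := [set p | _] in d2_le.
  set D3 := [set p | _] in d3_le; set D4 := [set p | _] in d4_le.
  have sub : [set p | pi (fsg_of lam (borel_comp x y)) p <>
      pinj_comp (pi (fsg_of lam x)) (pi (fsg_of lam y)) p] `<=`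
      (D3 `|` D4) `|` (D2 `|` ppreimage (mod c2) D1).
    move=> p ne; apply: contrapT => nD; apply: ne.
    have e1 r : mod c2 p = Some r -> pi (fsg_of lam x) r = mod c1 r.
      move=> pr'; apply: contrapT => ?; apply: nD; right; right.
      by apply/ppreimageP; exists r.
    have e2 : pi (fsg_of lam y) p = mod c2 p.
      by apply: contrapT => ?; apply: nD; right; left.
    have e3 : pi (fsg_of lam (borel_comp x y)) p = mod c3 p.
      by apply: contrapT => ?; apply: nD; left; left.
    have e4 : mod c3 p = pinj_comp (mod c1) (mod c2) p.
      by apply: contrapT => ?; apply: nD; left; right.
    rewrite e3 e4 [LHS]pcompE [RHS]pcompE e2.
    by case pr': (mod c2 p) => [r|//]; rewrite e1.
  have := cnt_subU F sub; have := cnt_setU_le F D3 D4.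
  have := cnt_setU_le F D2 (ppreimage (mod c2) D1).
  have := cnt_ppreimage_le F (mod c2) D1; lra.
- move=> x Kx; have [i ix] := K_phi x Kx.
  have [c cE d_le] := piP _ (ex_intro _ _ ix).
  rewrite (fsg_of_fix (esym cE)); have := mod_fix c.
  set D := [set p | _] in d_le.
  have s1 : pfix (pi (fsg_of lam x)) `<=` pfix (mod c) `|` D.
    move=> p px; have [e1|ne] := pselect (D p); [by right|left].
    have pip : pi (fsg_of lam x) p = mod c p by exact: contrapT.
    exact: etrans (esym pip) px.
  have s2 : pfix (mod c) `<=` pfix (pi (fsg_of lam x)) `|` D.
    move=> p px; have [e1|ne] := pselect (D p); [by right|left].
    have pip : pi (fsg_of lam x) p = mod c p by exact: contrapT.
    exact: etrans pip px.
  have := cnt_subU F s1; have := cnt_subU F s2.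
  rewrite ler_norml ltr_norml => l1 l2 /andP[l3 l4]; apply/andP.
  by move: l1 l2 l3 l4; split; lra.
Qed.

End ProductClasses.

Theorem theorem3p6 (F : realType) (d1 d2 : measure_display)
  (X : measurableType d1) (Y : measurableType d2)
  (mu : probability X F) (nu : probability Y F)
  (hX : standard_borel F X) (hY : standard_borel F Y)
  (R : cber X) (S : cber Y)
  (hR : measure_preserving mu R) (hS : measure_preserving nu S) :
  (sofic mu R /\ sofic nu S) <->
  sofic (mu \x nu)%E (cber_prod R S).
Proof.
have mX := standard_borel_diag hX; have mY := standard_borel_diag hY.
split=> [[sR sS]|sRS].
  by apply: sofic_prod => //; exact: sofic_matches_local_types.
by split; [exact: sofic_factor1 sRS|exact: sofic_factor2 sRS].
Qed.
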